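(* Let $k$ be a field, and let $A$ and $B$ be two finite dimensional $k$-algebras (of infinite global dimension) which are singularly equivalent of Morita type with level, i.e. there are $n\in\mathbb{N}$ and a pair $({}_AM_B,{}_BN_A)$ defining a singular equivalence of Morita type with level $n$ between $A$ and $B$. Then $\mathrm{HH}_i(A)\cong\mathrm{HH}_i(B)$ for all $i>0$.
   Context: $\mathrm{HH}_i$ denotes Hochschild homology over $k$. Conventions: $\otimes=\otimes_k$; $A^e=A\otimes A^{\mathrm{op}}$; $A\text{-}\underline{\mathrm{mod}}$ is the stable category, modulo projectives, of the category $A\text{-}\mathrm{mod}$ of finitely presented left $A$-modules; $\Omega^n_{A^e}(A)$ is the $n$-th syzygy of $A$ as an $A^e$-module. Singular equivalence of Morita type with level $n$ ($n\ge 0$): a pair $(M,N)$ of a finitely generated $A$-$B$-bimodule $M$ and a finitely generated $B$-$A$-bimodule $N$ (with $k$ acting centrally) such that (1) $M$ is projective as a left $A$-module and as a right $B$-module; (2) $N$ is projective as a left $B$-module and as a right $A$-module; (3) $M\otimes_BN\cong\Omega^n_{A^e}(A)$ in $A^e\text{-}\underline{\mathrm{mod}}$ and $N\otimes_AM\cong\Omega^n_{B^e}(B)$ in $B^e\text{-}\underline{\mathrm{mod}}$. *)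

(* Defs.v *)
From HB Require Import structures.
From mathcomp Require Import all_boot all_order all_algebra all_field.
From mathcomp Require Import boolp freeg zify.

Set Implicit Arguments.
Unset Strict Implicit.
Unset Printing Implicit Defensive.

Import GRing.Theory.
Local Open Scope ring_scope.
Local Open Scope quotient_scope.

Section QuotientModule.
Variables (R : pzRingType) (V : lmodType R) (S : V -> Prop).

Inductive lspan : V -> Prop :=
| lspan0 : lspan 0
| lspanZD c s x of S s & lspan x : lspan (c *: s + x).

Lemma lspanD x y : lspan x -> lspan y -> lspan (x + y).
Proof.
elim=> [|c s {}x Ss _ IH] sy; first by rewrite add0r.
by rewrite -addrA; apply: lspanZD => //; apply: IH.
Qed.

Lemma lspanZ c x : lspan x -> lspan (c *: x).
Proof.
elim=> [|d s {}x Ss _ IH]; first by rewrite scaler0; exact: lspan0.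
by rewrite scalerDr scalerA; apply: lspanZD.
Qed.

Lemma lspan_gen s : S s -> lspan s.
Proof. by move=> Ss; rewrite -[s]scale1r -[_ *: _]addr0; apply: lspanZD => //; exact: lspan0. Qed.

Definition lspan_pred : {pred V} := fun x => `[< lspan x >].

Lemma lspan_zmod_closed : zmod_closed lspan_pred.
Proof.
split; first by apply/asboolP; exact: lspan0.
move=> x y /asboolP sx /asboolP sy; apply/asboolP.
by rewrite -scaleN1r; apply: lspanD => //; apply: lspanZ.
Qed.

HB.instance Definition _ := GRing.isZmodClosed.Build V lspan_pred lspan_zmod_closed.

Definition lquot : Type := (Quotient.quot lspan_pred).
HB.instance Definition _ := GRing.Zmodule.on lquot.
HB.instance Definition _ := Quotient.on lquot.

Definition lquot_proj (x : V) : lquot := \pi_lquot x.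

Lemma lquot_projB : {morph lquot_proj : x y / x - y >-> x - y}.
Proof. by move=> x y; rewrite /lquot_proj; exact: (raddfB \pi_(Quotient.quot lspan_pred)). Qed.

Lemma lquot_proj_eqP x y :
  lquot_proj x = lquot_proj y <-> lspan (x - y).
Proof.
split=> [/eqP|sxy]; last apply/eqP.
  by rewrite -(Quotient.idealrBE lspan_pred) => /asboolP.
by rewrite -(Quotient.idealrBE lspan_pred); apply/asboolP.
Qed.

Lemma lquot_reprK x : lquot_proj (repr x) = x.
Proof. exact: reprK. Qed.

Definition lquot_scale (c : R) (x : lquot) : lquot := lquot_proj (c *: repr x).

Lemma lquot_scaleE c x : lquot_scale c (lquot_proj x) = lquot_proj (c *: x).
Proof.
apply/lquot_proj_eqP; rewrite -scalerBr; apply: lspanZ.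
by apply/lquot_proj_eqP; rewrite lquot_reprK.
Qed.

Lemma lquot_projN x : lquot_proj (- x) = - lquot_proj x.
Proof. by rewrite -[- x]sub0r lquot_projB -{1}(subrr x) lquot_projB subrr sub0r. Qed.

Lemma lquot_projD x y : lquot_proj (x + y) = lquot_proj x + lquot_proj y.
Proof. by rewrite -[y]opprK lquot_projB opprK lquot_projN opprK. Qed.

Lemma lquot_scaleA a b x : lquot_scale a (lquot_scale b x) = lquot_scale (a * b) x.
Proof. by rewrite -[x]lquot_reprK !lquot_scaleE scalerA. Qed.
Lemma lquot_scale1 : left_id 1 lquot_scale.
Proof. by move=> x; rewrite -[x]lquot_reprK lquot_scaleE scale1r. Qed.
Lemma lquot_scaleDr : right_distributive lquot_scale +%R.
Proof.
move=> c x y; rewrite -[x]lquot_reprK -[y]lquot_reprK -lquot_projD !lquot_scaleE.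
by rewrite -lquot_projD scalerDr.
Qed.
Lemma lquot_scaleDl x : {morph lquot_scale^~ x : a b / a + b}.
Proof. by move=> a b; rewrite -[x]lquot_reprK !lquot_scaleE -lquot_projD scalerDl. Qed.

HB.instance Definition _ := GRing.Zmodule_isLmodule.Build R lquot
  lquot_scaleA lquot_scale1 lquot_scaleDr lquot_scaleDl.

Lemma lquot_proj_linear : linear lquot_proj.
Proof. by move=> c x y; rewrite lquot_projD -lquot_scaleE. Qed.
HB.instance Definition _ :=
  GRing.isLinear.Build R V lquot _ lquot_proj lquot_proj_linear.

Lemma lquot_projK x : lquot_proj (repr x) = x.
Proof. exact: lquot_reprK. Qed.

Lemma lquot_proj0 s : S s -> lquot_proj s = 0.
Proof.
move=> Ss; rewrite -(raddf0 lquot_proj); apply/lquot_proj_eqP.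
by rewrite subr0; exact: lspan_gen.
Qed.

Section Lift.
Variables (W : lmodType R) (f : {linear V -> W}) (f0 : forall s, S s -> f s = 0).

Definition lquot_lift (_ : forall s, S s -> f s = 0) (x : lquot) : W := f (repr x).

Lemma lquot_liftE x : lquot_lift f0 (lquot_proj x) = f x.
Proof.
apply/eqP; rewrite -subr_eq0 -linearB; apply/eqP.
have : lspan (repr (lquot_proj x) - x) by apply/lquot_proj_eqP; rewrite lquot_reprK.
elim=> [|c s {}x Ss _ IH]; first exact: linear0.
by rewrite linearP f0 // scaler0 add0r.
Qed.

Lemma lquot_lift_linear : linear (lquot_lift f0).
Proof.
move=> c x y; rewrite -[x]lquot_projK -[y]lquot_projK -linearP.
by rewrite !lquot_liftE linearP.
Qed.
HB.instance Definition _ :=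
  GRing.isLinear.Build R lquot W _ (lquot_lift f0) lquot_lift_linear.
End Lift.
End QuotientModule.

Arguments lquot_proj : simpl never.
Arguments lquot_lift : simpl never.

Section FreeLift.
Variables (R : nzRingType) (K : choiceType) (W : lmodType R) (f : K -> W).

Definition free_lift (x : {freeg K / R}) : W := fglift f x.

Lemma free_lift_zmod : zmod_morphism free_lift.
Proof. exact: (@lift_is_additive R K W f). Qed.
HB.instance Definition _ :=
  GRing.isZmodMorphism.Build {freeg K / R} W free_lift free_lift_zmod.

Lemma free_lift_scalable : scalable free_lift.
Proof.
move=> c x; have -> : c *: x = \sum_(y <- dom x) << c * coeff y x *g y >> by [].
rewrite -[x in RHS]freeg_sumE !raddf_sum; apply: eq_bigr => y _.
by rewrite /= /free_lift !liftU scalerA.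
Qed.
HB.instance Definition _ :=
  GRing.isScalable.Build R {freeg K / R} W *:%R free_lift free_lift_scalable.

Lemma free_liftE x : free_lift << x >> = f x.
Proof. by rewrite /free_lift liftU scale1r. Qed.
End FreeLift.

Arguments free_lift : simpl never.

Lemma freeg_ind (R : nzRingType) (K : choiceType) (P : {freeg K / R} -> Prop) :
    P 0 -> (forall c t x, P x -> P (c *: << t >> + x)) -> forall x, P x.
Proof.
move=> P0 PS x; rewrite -[x]freeg_sumE.
elim: (dom x) => [|t s IH]; first by rewrite big_nil.
rewrite big_cons.
suff -> : << coeff t x *g t >> = coeff t x *: << t >> :> {freeg K / R} by exact: PS.
by apply/eqP/freeg_eqP => y; rewrite coeffZ !coeffU mul1r.
Qed.

Section Tensor.
Variables (k : fieldType) (U V : lmodType k).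

Inductive bilin_rel : {freeg (U * V)%type / k} -> Prop :=
| bilin_rel_l c u u' v :
    bilin_rel (<< (c *: u + u', v) >> - (c *: << (u, v) >> + << (u', v) >>))
| bilin_rel_r c u v v' :
    bilin_rel (<< (u, c *: v + v') >> - (c *: << (u, v) >> + << (u, v') >>)).

Definition tensor : Type := lquot bilin_rel.
HB.instance Definition _ := GRing.Lmodule.on tensor.

Definition tens (u : U) (v : V) : tensor := lquot_proj bilin_rel << (u, v) >>.

Lemma tens_linearl v : linear (tens^~ v).
Proof.
move=> c u u'; rewrite /tens; apply/eqP; rewrite -subr_eq0 -!linearP -linearB.
by apply/eqP/lquot_proj0; exact: bilin_rel_l.
Qed.

Lemma tens_linearr u : linear (tens u).
Proof.
move=> c v v'; rewrite /tens; apply/eqP; rewrite -subr_eq0 -!linearP -linearB.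
by apply/eqP/lquot_proj0; exact: bilin_rel_r.
Qed.

Lemma tensZl c u v : tens (c *: u) v = c *: tens u v.
Proof.
have := tens_linearl v (-1) 0 0; rewrite scaler0 addr0 scaleN1r addNr => t0.
by have := tens_linearl v c u 0; rewrite t0 !addr0.
Qed.

Lemma tensZr c u v : tens u (c *: v) = c *: tens u v.
Proof.
have := tens_linearr u (-1) 0 0; rewrite scaler0 addr0 scaleN1r addNr => t0.
by have := tens_linearr u c v 0; rewrite t0 !addr0.
Qed.

Lemma tensor_ind (P : tensor -> Prop) :
    P 0 -> (forall x y, P x -> P y -> P (x + y)) -> (forall u v, P (tens u v)) ->
  forall x, P x.
Proof.
move=> P0 PD Pt x; rewrite -[x]lquot_projK.
elim/freeg_ind: (repr x) => [|c [u v] {}x IH]; first by rewrite linear0.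
rewrite linearP /=; apply: PD => //.
by rewrite -[c *: _]tensZl.
Qed.

Section Lift.
Variables (W : lmodType k) (f : U -> V -> W).
Hypotheses (fl : forall v, linear (f^~ v)) (fr : forall u, linear (f u)).

Lemma tensor_lift_rel s : bilin_rel s -> free_lift (fun uv => f uv.1 uv.2) s = 0.
Proof.
case=> [c u u' v|c u v v']; rewrite linearB linearP /= !free_liftE /=.
  by rewrite fl subrr.
by rewrite fr subrr.
Qed.

Definition tensor_lift : tensor -> W := lquot_lift tensor_lift_rel.
HB.instance Definition _ := GRing.Linear.on tensor_lift.

Lemma tensor_liftE u v : tensor_lift (tens u v) = f u v.
Proof. by rewrite /tensor_lift lquot_liftE /= free_liftE. Qed.
End Lift.

Lemma tensor_ext (W : lmodType k) (f g : {linear tensor -> W}) :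
  (forall u v, f (tens u v) = g (tens u v)) -> f =1 g.
Proof.
move=> fg x; elim/tensor_ind: x => [|x y fx fy|//]; first by rewrite !linear0.
by rewrite !linearD fx fy.
Qed.
End Tensor.

Arguments tensor_lift : simpl never.

(* The algebra A ⊗ B^op, with (a ⊗ b)(a' ⊗ b') = a a' ⊗ b' b; its left modules
   are the A-B-bimodules on which k acts centrally. *)

Section TensorOp.
Variables (k : fieldType) (A B : algType k).

Definition tensop : Type := tensor A B.
HB.instance Definition _ := GRing.Lmodule.on tensop.

Definition tensop_tens (a : A) (b : B) : tensop := tens a b.

Definition tensop_mulf a b (a' : A) (b' : B) : tensop := tens (a * a') (b' * b).

Lemma tensop_mulf_linearl a b b' : linear ((tensop_mulf a b)^~ b').
Proof.
by move=> c x y; rewrite /tensop_mulf mulrDr -scalerAr; exact: tens_linearl.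
Qed.
Lemma tensop_mulf_linearr a b a' : linear (tensop_mulf a b a').
Proof.
by move=> c x y; rewrite /tensop_mulf mulrDl -scalerAl; exact: tens_linearr.
Qed.

Definition tensop_lmul a b : tensop -> tensop :=
  tensor_lift (tensop_mulf_linearl a b) (tensop_mulf_linearr a b).
HB.instance Definition _ a b := GRing.Linear.on (tensop_lmul a b).

Lemma tensop_lmulE a b a' b' :
  tensop_lmul a b (tens a' b') = tens (a * a') (b' * b).
Proof. exact: tensor_liftE. Qed.

Lemma tensop_lmul_linearl y b : linear (fun a => tensop_lmul a b y).
Proof.
move=> c a a'; elim/tensor_ind: y => [|x y IHx IHy|a1 b1].
- by rewrite !linear0 addr0.
- by rewrite !linearD /= IHx IHy addrACA.
- by rewrite !tensop_lmulE mulrDl -scalerAl; exact: tens_linearl.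
Qed.

Lemma tensop_lmul_linearr y a : linear (fun b => tensop_lmul a b y).
Proof.
move=> c b b'; elim/tensor_ind: y => [|x y IHx IHy|a1 b1].
- by rewrite !linear0 addr0.
- by rewrite !linearD /= IHx IHy addrACA.
- by rewrite !tensop_lmulE mulrDr -scalerAr; exact: tens_linearr.
Qed.

Definition tensop_mul (x y : tensop) : tensop :=
  tensor_lift (tensop_lmul_linearl y) (tensop_lmul_linearr y) x.

Lemma tensop_mulE a b a' b' :
  tensop_mul (tens a b) (tens a' b') = tens (a * a') (b' * b).
Proof. by rewrite /tensop_mul tensor_liftE tensop_lmulE. Qed.

Lemma tensop_mulDl : left_distributive tensop_mul +%R.
Proof. by move=> x y z; rewrite /tensop_mul linearD. Qed.
Lemma tensop_mulDr : right_distributive tensop_mul +%R.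
Proof.
move=> x y z; elim/tensor_ind: x => [|x x' IH IH'|a b].
- by rewrite /tensop_mul !linear0 addr0.
- by rewrite !tensop_mulDl IH IH' addrACA.
- by rewrite /tensop_mul !tensor_liftE linearD.
Qed.
Lemma tensop_mul0l x : tensop_mul 0 x = 0.
Proof. by rewrite /tensop_mul linear0. Qed.
Lemma tensop_mul0r x : tensop_mul x 0 = 0.
Proof. by apply: (addrI (tensop_mul x 0)); rewrite -tensop_mulDr !addr0. Qed.

Lemma tensop_mulA : associative tensop_mul.
Proof.
move=> x y z; elim/tensor_ind: x => [|x x' IH IH'|a b].
- by rewrite !tensop_mul0l.
- by rewrite !tensop_mulDl IH IH'.
elim/tensor_ind: y => [|y y' IH IH'|a' b'].
- by rewrite !(tensop_mul0l, tensop_mul0r).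
- by rewrite !(tensop_mulDl, tensop_mulDr) IH IH'.
elim/tensor_ind: z => [|z z' IH IH'|a'' b''].
- by rewrite !(tensop_mul0l, tensop_mul0r).
- by rewrite !tensop_mulDr IH IH'.
- by rewrite !tensop_mulE !mulrA.
Qed.

Lemma tensop_mul1l : left_id (tens 1 1) tensop_mul.
Proof.
elim/tensor_ind => [|y y' IH IH'|a' b']; first exact: tensop_mul0r.
- by rewrite tensop_mulDr IH IH'.
- by rewrite tensop_mulE mul1r mulr1.
Qed.
Lemma tensop_mul1r : right_id (tens 1 1) tensop_mul.
Proof.
elim/tensor_ind => [|y y' IH IH'|a' b']; first exact: tensop_mul0l.
- by rewrite tensop_mulDl IH IH'.
- by rewrite tensop_mulE mul1r mulr1.
Qed.

HB.instance Definition _ := GRing.Zmodule_isPzRing.Build tensop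
  tensop_mulA tensop_mul1l tensop_mul1r tensop_mulDl tensop_mulDr.

Lemma tensop_mul_tens a b a' b' :
  tensop_tens a b * tensop_tens a' b' = tensop_tens (a * a') (b' * b).
Proof. exact: tensop_mulE. Qed.

Definition tensop_inl_fun (a : A) : tensop := tensop_tens a 1.
Lemma tensop_inl_zmod : zmod_morphism tensop_inl_fun.
Proof.
move=> a a'; have := tens_linearl (1 : B) (-1) a' a.
by rewrite !scaleN1r ![- _ + _]addrC.
Qed.
Lemma tensop_inl_monoid : monoid_morphism tensop_inl_fun.
Proof. by split=> // a a'; rewrite /tensop_inl_fun tensop_mul_tens mulr1. Qed.
HB.instance Definition _ :=
  GRing.isZmodMorphism.Build A tensop tensop_inl_fun tensop_inl_zmod.
HB.instance Definition _ :=
  GRing.isMonoidMorphism.Build A tensop tensop_inl_fun tensop_inl_monoid.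
Definition tensop_inl : {rmorphism A -> tensop} := tensop_inl_fun.

Definition tensop_inr_fun (b : B^c) : tensop := tensop_tens 1 b.
Lemma tensop_inr_zmod : zmod_morphism tensop_inr_fun.
Proof.
move=> b b'; have := tens_linearr (1 : A) (-1) (b' : B) (b : B).
by rewrite !scaleN1r ![- _ + _]addrC.
Qed.
Lemma tensop_inr_monoid : monoid_morphism tensop_inr_fun.
Proof. by split=> // b b'; rewrite /tensop_inr_fun tensop_mul_tens mulr1. Qed.
HB.instance Definition _ :=
  GRing.isZmodMorphism.Build B^c tensop tensop_inr_fun tensop_inr_zmod.
HB.instance Definition _ :=
  GRing.isMonoidMorphism.Build B^c tensop tensop_inr_fun tensop_inr_monoid.
Definition tensop_inr : {rmorphism B^c -> tensop} := tensop_inr_fun.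
End TensorOp.

Arguments tensop_lmul : simpl never.

Section Restriction.
Variables (R S : pzRingType) (f : {rmorphism R -> S}) (M : lmodType S).

Definition restr (_ : {rmorphism R -> S}) : Type := M.
HB.instance Definition _ := GRing.Zmodule.on (restr f).

Definition restr_scale (c : R) (x : restr f) : restr f := f c *: (x : M).

Lemma restr_scaleA a b x : restr_scale a (restr_scale b x) = restr_scale (a * b) x.
Proof. by rewrite /restr_scale scalerA rmorphM. Qed.
Lemma restr_scale1 : left_id 1 restr_scale.
Proof. by move=> x; rewrite /restr_scale rmorph1 scale1r. Qed.
Lemma restr_scaleDr : right_distributive restr_scale +%R.
Proof. by move=> c x y; exact: scalerDr. Qed.
Lemma restr_scaleDl x : {morph restr_scale^~ x : a b / a + b}.
Proof. by move=> a b; rewrite /restr_scale rmorphD; exact: scalerDl. Qed.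

HB.instance Definition _ := GRing.Zmodule_isLmodule.Build R (restr f)
  restr_scaleA restr_scale1 restr_scaleDr restr_scaleDl.
End Restriction.

Notation bimodType A B := (lmodType (tensop A B)).

Section Bimodule.
Variables (k : fieldType) (A B : algType k).

Section Actions.
Variable M : bimodType A B.

Definition lact (a : A) (x : M) : M := tensop_tens a 1 *: x.
Definition ract (x : M) (b : B) : M := tensop_tens 1 b *: x.

Definition left_module : lmodType A := restr M (tensop_inl A B).
Definition right_module : lmodType B^c := restr M (tensop_inr A B).

Definition tensop_scal : {rmorphism k -> tensop A B} := tensop_inl A B \o in_alg A.
Definition vspace_module : lmodType k := restr M tensop_scal.

Lemma vspace_scaleE c (x : vspace_module) : c *: x = tensop_tens c%:A 1 *: (x : M).
Proof. by []. Qed.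

Lemma lact_linear a : linear (lact a : vspace_module -> vspace_module).
Proof.
move=> c x y; rewrite /lact scalerDr; congr (_ + _).
rewrite !vspace_scaleE /= !scalerA.
by rewrite !tensop_mul_tens mulr_algr mulr_algl.
Qed.

Lemma ract_linear b : linear ((ract^~ b) : vspace_module -> vspace_module).
Proof.
move=> c x y; rewrite /ract scalerDr; congr (_ + _).
rewrite !vspace_scaleE /= !scalerA.
by rewrite !tensop_mul_tens !(mulr1, mul1r).
Qed.

Lemma lact_ract a x b : lact a (ract x b) = ract (lact a x) b.
Proof. by rewrite /lact /ract !scalerA !tensop_mul_tens !(mulr1, mul1r). Qed.

Lemma lactM a a' x : lact (a * a') x = lact a (lact a' x).
Proof. by rewrite /lact scalerA tensop_mul_tens mulr1. Qed.

Lemma ractM b b' x : ract x (b * b') = ract (ract x b) b'.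
Proof. by rewrite /ract scalerA tensop_mul_tens mulr1. Qed.

Lemma lact1 x : lact 1 x = x. Proof. exact: scale1r. Qed.
Lemma ract1 x : ract x 1 = x. Proof. exact: scale1r. Qed.

Lemma lact_linearl x : linear ((lact^~ x) : A -> vspace_module).
Proof.
move=> c a a'; rewrite /lact [tensop_tens _ _]tens_linearl scalerDl; congr (_ + _).
rewrite !vspace_scaleE /= scalerA.
rewrite tensop_mul_tens mulr_algl mulr1.
by rewrite /tensop_tens tensZl.
Qed.

Lemma ract_linearr x : linear (ract x : B -> vspace_module).
Proof.
move=> c b b'; rewrite /ract [tensop_tens _ _]tens_linearr scalerDl; congr (_ + _).
rewrite !vspace_scaleE /= scalerA.
rewrite tensop_mul_tens !mulr1.
by rewrite /tensop_tens tensZl.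
Qed.
End Actions.

Section OfActions.
Variables (T : lmodType k) (l : A -> T -> T) (r : T -> B -> T).

Record bimodule_laws : Prop := BimoduleLaws {
  bl_linearl : forall x, linear (l^~ x);
  bl_linear : forall a, linear (l a);
  bl_one : forall x, l 1 x = x;
  bl_mul : forall a a' x, l (a * a') x = l a (l a' x);
  br_linearr : forall x, linear (r x);
  br_linear : forall b, linear (r^~ b);
  br_one : forall x, r x 1 = x;
  br_mul : forall b b' x, r x (b * b') = r (r x b) b';
  bl_br : forall a x b, l a (r x b) = r (l a x) b }.

Variable laws : bimodule_laws.

Definition bimodule_of (_ : bimodule_laws) : Type := T.
HB.instance Definition _ := GRing.Zmodule.on (bimodule_of laws).

Lemma bimodule_act_linearl x b : linear (fun a => l a (r x b)).
Proof. exact: (bl_linearl laws (r x b)). Qed.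
Lemma bimodule_act_linearr x a : linear (fun b => l a (r x b)).
Proof. by move=> c b b'; rewrite (br_linearr laws) (bl_linear laws). Qed.

Definition bimodule_scale (t : tensop A B) (x : bimodule_of laws) : bimodule_of laws :=
  tensor_lift (bimodule_act_linearl x) (bimodule_act_linearr x) t.

Lemma bimodule_scaleE a b x : bimodule_scale (tensop_tens a b) x = l a (r x b).
Proof. exact: tensor_liftE. Qed.

Lemma bimodule_scaleDl x : {morph bimodule_scale^~ x : s t / s + t}.
Proof. by move=> s t; rewrite /bimodule_scale linearD. Qed.
Lemma bimodule_scaleDr : right_distributive bimodule_scale +%R.
Proof.
move=> t x y; elim/tensor_ind: t => [|s t IHs IHt|a b].
- by rewrite /bimodule_scale !linear0 addr0.
- by rewrite !bimodule_scaleDl IHs IHt addrACA.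
- rewrite !bimodule_scaleE.
  have rD := br_linear laws b 1 x y; have lD := bl_linear laws a 1 (r x b) (r y b).
  by rewrite !scale1r in rD lD; rewrite rD lD.
Qed.
Lemma bimodule_scale1 : left_id 1 bimodule_scale.
Proof. by move=> x; rewrite [LHS]bimodule_scaleE (br_one laws) (bl_one laws). Qed.
Lemma bimodule_scaleA s t x :
  bimodule_scale s (bimodule_scale t x) = bimodule_scale (s * t) x.
Proof.
elim/tensor_ind: s => [|s s' IH IH'|a b].
- by rewrite mul0r /bimodule_scale !linear0.
- by rewrite mulrDl !bimodule_scaleDl IH IH'.
elim/tensor_ind: t => [|t t' IH IH'|a' b'].
- have s0 : bimodule_scale 0 x = 0 by rewrite /bimodule_scale linear0.
  rewrite mulr0 s0; apply: (addrI (bimodule_scale (tensop_tens a b) 0)).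
  by rewrite -bimodule_scaleDr !addr0.
- by rewrite mulrDr !bimodule_scaleDl bimodule_scaleDr IH IH'.
rewrite tensop_mul_tens !bimodule_scaleE.
by rewrite (bl_mul laws) (br_mul laws) -(bl_br laws).
Qed.

HB.instance Definition _ := GRing.Zmodule_isLmodule.Build (tensop A B) (bimodule_of laws)
  bimodule_scaleA bimodule_scale1 bimodule_scaleDr bimodule_scaleDl.
End OfActions.
End Bimodule.

Section RegularBimodule.
Variables (k : fieldType) (A : algType k).

Lemma regular_laws :
  bimodule_laws (fun a x : A => a * x) (fun x a : A => x * a).
Proof.
by split=> *; rewrite ?mul1r ?mulr1 ?mulrA // => c y z;
   rewrite ?mulrDl ?mulrDr -?scalerAl -?scalerAr.
Qed.

Definition regular_bimodule : bimodType A A := bimodule_of regular_laws.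
End RegularBimodule.

Section TensorOver.
Variables (k : fieldType) (A B C : algType k).
Variables (M : bimodType A B) (N : bimodType B C).

Inductive balanced_rel : tensor (vspace_module M) (vspace_module N) -> Prop :=
| Balanced (x : M) (b : B) (y : N) :
    balanced_rel (tens (ract x b : vspace_module M) (y : vspace_module N)
                  - tens (x : vspace_module M) (lact b y : vspace_module N)).

Definition tensor_over_vspace : Type := lquot balanced_rel.
HB.instance Definition _ := GRing.Lmodule.on tensor_over_vspace.

Definition tens_over (x : M) (y : N) : tensor_over_vspace :=
  lquot_proj balanced_rel (tens (x : vspace_module M) (y : vspace_module N)).

Lemma tens_over_linearl y : linear ((tens_over^~ y) : vspace_module M -> _).
Proof. by move=> c x x'; rewrite /tens_over tens_linearl linearP. Qed.
Lemma tens_over_linearr x : linear ((tens_over x) : vspace_module N -> _).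
Proof. by move=> c y y'; rewrite /tens_over tens_linearr linearP. Qed.

Lemma tens_over_balanced x b y : tens_over (ract x b) y = tens_over x (lact b y).
Proof.
by apply/eqP; rewrite -subr_eq0 -linearB; apply/eqP/lquot_proj0; constructor.
Qed.

Lemma tensor_over_ind (P : tensor_over_vspace -> Prop) :
    P 0 -> (forall x y, P x -> P y -> P (x + y)) ->
    (forall x y, P (tens_over x y)) ->
  forall t, P t.
Proof.
move=> P0 PD Pt t; rewrite -[t]lquot_projK.
elim/tensor_ind: (repr t) => [|x y Px Py|x y]; first by rewrite linear0.
- by rewrite linearD; apply: PD.
- exact: Pt.
Qed.

Section Lift.
Variables (W : lmodType k) (f : M -> N -> W).
Hypotheses (fl : forall y, linear ((f^~ y) : vspace_module M -> W)).
Hypotheses (fr : forall x, linear (f x : vspace_module N -> W)).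
Hypothesis fb : forall x b y, f (ract x b) y = f x (lact b y).

Lemma tensor_over_lift_rel s : balanced_rel s ->
  @tensor_lift k (vspace_module M) (vspace_module N) W f fl fr s = 0.
Proof. by case=> x b y; rewrite linearB /= !tensor_liftE fb subrr. Qed.

Definition tensor_over_lift : tensor_over_vspace -> W :=
  lquot_lift tensor_over_lift_rel.
HB.instance Definition _ := GRing.Linear.on tensor_over_lift.

Lemma tensor_over_liftE x y : tensor_over_lift (tens_over x y) = f x y.
Proof. by rewrite /tensor_over_lift lquot_liftE /= tensor_liftE. Qed.
End Lift.

Definition tensor_over_lactf a x y := tens_over (lact a x) y.

Lemma tensor_over_lactf_l a y :
  linear (((tensor_over_lactf a)^~ y) : vspace_module M -> _).
Proof. by move=> c x x'; rewrite /tensor_over_lactf [lact _ _]lact_linear; exact: tens_over_linearl. Qed.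
Lemma tensor_over_lactf_r a x :
  linear ((tensor_over_lactf a x) : vspace_module N -> _).
Proof. exact: tens_over_linearr. Qed.
Lemma tensor_over_lactf_b a x b y :
  tensor_over_lactf a (ract x b) y = tensor_over_lactf a x (lact b y).
Proof. by rewrite /tensor_over_lactf lact_ract tens_over_balanced. Qed.

Definition tensor_over_lact a : tensor_over_vspace -> tensor_over_vspace :=
  tensor_over_lift (tensor_over_lactf_l a) (tensor_over_lactf_r a)
    (tensor_over_lactf_b a).
HB.instance Definition _ a := GRing.Linear.on (tensor_over_lact a).

Lemma tensor_over_lactE a x y :
  tensor_over_lact a (tens_over x y) = tens_over (lact a x) y.
Proof. exact: tensor_over_liftE. Qed.

Definition tensor_over_ractf c x y := tens_over x (ract y c).

Lemma tensor_over_ractf_l c y :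
  linear (((tensor_over_ractf c)^~ y) : vspace_module M -> _).
Proof. exact: tens_over_linearl. Qed.
Lemma tensor_over_ractf_r c x :
  linear ((tensor_over_ractf c x) : vspace_module N -> _).
Proof. by move=> d y y'; rewrite /tensor_over_ractf [ract _ _]ract_linear; exact: tens_over_linearr. Qed.
Lemma tensor_over_ractf_b c x b y :
  tensor_over_ractf c (ract x b) y = tensor_over_ractf c x (lact b y).
Proof. by rewrite /tensor_over_ractf tens_over_balanced lact_ract. Qed.

Definition tensor_over_ract c : tensor_over_vspace -> tensor_over_vspace :=
  tensor_over_lift (tensor_over_ractf_l c) (tensor_over_ractf_r c)
    (tensor_over_ractf_b c).
HB.instance Definition _ c := GRing.Linear.on (tensor_over_ract c).

Lemma tensor_over_ractE c x y :
  tensor_over_ract c (tens_over x y) = tens_over x (ract y c).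
Proof. exact: tensor_over_liftE. Qed.

Lemma tensor_over_laws :
  bimodule_laws (fun a => tensor_over_lact a) (fun t c => tensor_over_ract c t).
Proof.
split.
- move=> t c a a'; elim/tensor_over_ind: t => [|s t IHs IHt|x y].
  + by rewrite !linear0 addr0.
  + by rewrite !linearD /= IHs IHt addrACA.
  + by rewrite !tensor_over_lactE [lact _ x]lact_linearl; exact: tens_over_linearl.
- by move=> a c s t; rewrite linearP.
- elim/tensor_over_ind => [|s t IHs IHt|x y]; first exact: linear0.
  + by rewrite linearD /= IHs IHt.
  + by rewrite tensor_over_lactE lact1.
- move=> a a'; elim/tensor_over_ind => [|s t IHs IHt|x y]; first by rewrite !linear0.
  + by rewrite !linearD /= IHs IHt.
  + by rewrite !tensor_over_lactE lactM.
- move=> t d c c'; elim/tensor_over_ind: t => [|s t IHs IHt|x y].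
  + by rewrite !linear0 addr0.
  + by rewrite !linearD /= IHs IHt addrACA.
  + by rewrite !tensor_over_ractE [ract y _]ract_linearr; exact: tens_over_linearr.
- by move=> c d s t; rewrite linearP.
- elim/tensor_over_ind => [|s t IHs IHt|x y]; first exact: linear0.
  + by rewrite linearD /= IHs IHt.
  + by rewrite tensor_over_ractE ract1.
- move=> c c'; elim/tensor_over_ind => [|s t IHs IHt|x y]; first by rewrite !linear0.
  + by rewrite !linearD /= IHs IHt.
  + by rewrite !tensor_over_ractE ractM.
- move=> a t c; elim/tensor_over_ind: t => [|s t IHs IHt|x y]; first by rewrite !linear0.
  + by rewrite !linearD /= IHs IHt.
  + by rewrite !(tensor_over_ractE, tensor_over_lactE).
Qed.

Definition tensor_over : bimodType A C := bimodule_of tensor_over_laws.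
End TensorOver.

Arguments tensor_over_lift : simpl never.
Arguments tensor_over_lact : simpl never.
Arguments tensor_over_ract : simpl never.

Section ModuleTheory.
Variable R : pzRingType.
Implicit Types K L M N P : lmodType R.

Definition lin_isomorphic M N : Prop := exists f : {linear M -> N}, bijective f.

Definition lin_surjective M N (f : {linear M -> N}) : Prop :=
  forall y, exists x, f x = y.

Definition lin_exact M N P (f : {linear M -> N}) (g : {linear N -> P}) : Prop :=
  forall y, g y = 0 <-> exists x, f x = y.

Definition finitely_generated M : Prop :=
  exists (n : nat) (g : 'I_n -> M),
    forall x, exists c : 'I_n -> R, x = \sum_(i < n) c i *: g i.

Definition finitely_presented M : Prop :=
  exists (m n : nat) (f : {linear 'rV[R]_m -> 'rV[R]_n}) (g : {linear 'rV[R]_n -> M}),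
    lin_exact f g /\ lin_surjective g.

Definition projective P : Prop :=
  forall M N (p : {linear M -> N}) (f : {linear P -> N}), lin_surjective p ->
    exists g : {linear P -> M}, forall x, p (g x) = f x.

Definition stably_eq M N (f g : {linear M -> N}) : Prop :=
  exists (P : lmodType R) (u : {linear M -> P}) (v : {linear P -> N}),
    [/\ finitely_presented P, projective P & forall x, f x - g x = v (u x)].

(* The objects of the stable category are the finitely presented modules, so the
   projective through which a map factors is finitely presented too. *)
Definition stably_isomorphic M N : Prop :=
  [/\ finitely_presented M, finitely_presented N &
    exists (f : {linear M -> N}) (g : {linear N -> M}),
      stably_eq (g \o f) idfun /\ stably_eq (f \o g) idfun].

Definition short_exact K P M (i : {linear K -> P}) (p : {linear P -> M}) : Prop :=
  [/\ injective i, lin_exact i p & lin_surjective p].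

(* K is an n-th syzygy of M: the n-th kernel in some resolution of M by finitely
   presented projectives; it is only determined up to stable isomorphism *)
Fixpoint is_syzygy (n : nat) M K : Prop :=
  if n is n'.+1 then
    exists (P L : lmodType R) (i : {linear L -> P}) (p : {linear P -> M}),
      [/\ finitely_presented P, projective P, short_exact i p & is_syzygy n' L K]
  else lin_isomorphic M K.

Fixpoint proj_dim_le (n : nat) M : Prop :=
  if n is n'.+1 then
    exists (P L : lmodType R) (i : {linear L -> P}) (p : {linear P -> M}),
      [/\ projective P, short_exact i p & proj_dim_le n' L]
  else projective M.

Definition infinite_global_dimension : Prop :=
  forall n, exists M, ~ proj_dim_le n M.
End ModuleTheory.

Section TensorPower.
Variables (k : fieldType) (V : lmodType k) (m : nat).

Definition ffset (t : {ffun 'I_m -> V}) (p : 'I_m) (x : V) : {ffun 'I_m -> V} :=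
  [ffun j => if j == p then x else t j].

Inductive multilin_rel : {freeg {ffun 'I_m -> V} / k} -> Prop :=
| MultilinRel t p c x y :
    multilin_rel (<< ffset t p (c *: x + y) >>
                  - (c *: << ffset t p x >> + << ffset t p y >>)).

Definition tensor_power : Type := lquot multilin_rel.
HB.instance Definition _ := GRing.Lmodule.on tensor_power.

Definition mtens (t : {ffun 'I_m -> V}) : tensor_power :=
  lquot_proj multilin_rel << t >>.

Definition multilinear (W : lmodType k) (f : {ffun 'I_m -> V} -> W) : Prop :=
  forall t p, linear (fun x => f (ffset t p x)).

Lemma mtens_multilinear : multilinear mtens.
Proof.
move=> t p c x y; rewrite /mtens; apply/eqP; rewrite -subr_eq0 -!linearP -linearB.
by apply/eqP/lquot_proj0; constructor.
Qed.

Section Lift.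
Variables (W : lmodType k) (f : {ffun 'I_m -> V} -> W) (fm : multilinear f).

Lemma tensor_power_lift_rel s : multilin_rel s -> free_lift f s = 0.
Proof. by case=> t p c x y; rewrite linearB linearP /= !free_liftE fm subrr. Qed.

Definition tensor_power_lift : tensor_power -> W :=
  lquot_lift tensor_power_lift_rel.
HB.instance Definition _ := GRing.Linear.on tensor_power_lift.

Lemma tensor_power_liftE t : tensor_power_lift (mtens t) = f t.
Proof. by rewrite /tensor_power_lift lquot_liftE /= free_liftE. Qed.
End Lift.

Lemma tensor_power_ext (W : lmodType k) (f g : {linear tensor_power -> W}) :
  (forall t, f (mtens t) = g (mtens t)) -> f =1 g.
Proof.
move=> fg x; rewrite -[x]lquot_projK.
elim/freeg_ind: (repr x) => [|c t {}x IH]; first by rewrite !linear0.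
by rewrite !linearP IH; congr (_ *: _ + _); exact: fg.
Qed.
End TensorPower.

Arguments tensor_power_lift : simpl never.

Section Homology.
Variables (k : fieldType) (U V W : lmodType k).
Variables (f : {linear U -> V}) (g : {linear V -> W}).

Definition cycle_pred : {pred V} := fun x => g x == 0.
Lemma cycle_submod_closed : submod_closed cycle_pred.
Proof.
split=> [|c x y]; rewrite !unfold_in ?linear0 // => /eqP gx /eqP gy.
by rewrite linearP gx gy scaler0 addr0.
Qed.
HB.instance Definition _ := GRing.isSubmodClosed.Build k V cycle_pred cycle_submod_closed.

Definition cycles : Type := {x : V | x \in cycle_pred}.
HB.instance Definition _ := SubChoice.on cycles.
HB.instance Definition _ := [SubChoice_isSubLmodule of cycles by <:].

Inductive boundary_rel : cycles -> Prop :=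
| BoundaryRel (z : cycles) (u : U) of val z = f u : boundary_rel z.

Definition homology : lmodType k := lquot boundary_rel.
End Homology.

Notation hoch_chain A n := (tensor_power A n.+1).

Lemma sum_cancel (V : zmodType) (F : nat -> nat -> V) m :
  (forall i j, (i < j)%N -> (j <= m)%N -> F j i = - F i j.-1) ->
  \sum_(j < m.+1) \sum_(i < m) F j i = 0.
Proof.
elim: m => [|m IH] FN; first by rewrite big1 // => j _; rewrite big_ord0.
rewrite big_ord_recr /= (eq_bigr (fun j : 'I_m.+1 => \sum_(i < m) F j i + F j m));
  last by move=> j _; rewrite big_ord_recr.
rewrite big_split /=.
rewrite IH ?add0r => [|i j ij jm]; last by apply: FN => //; exact: leqW.
by rewrite -big_split big1 //= => i _; rewrite (FN i m.+1) //= subrr.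
Qed.

Section Hochschild.
Variables (k : fieldType) (A : algType k).

(* The i-th face replaces, for i <= n, the entries i and i+1 by their product
   a_i a_(i+1), and for i = n+1 the entries n+1 and 0 by a_(n+1) a_0: in both
   cases entry i is deleted and multiplied on the left into its cyclic
   successor, which lands at position i mod n+1. *)
Definition hoch_face n (i : 'I_n.+2) (t : {ffun 'I_n.+2 -> A}) : {ffun 'I_n.+1 -> A} :=
  [ffun j : 'I_n.+1 =>
    if j == (i %% n.+1)%N :> nat then t i * t (fintype.lift i j) else t (fintype.lift i j)].

Definition hoch_bound n (t : {ffun 'I_n.+2 -> A}) : hoch_chain A n :=
  \sum_(i < n.+2) (-1) ^+ i *: mtens (hoch_face i t).

Lemma hoch_bound_multilinear n : multilinear (@hoch_bound n).
Proof.
move=> t p; rewrite /hoch_bound => c x y.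
rewrite scaler_sumr -big_split /=; apply: eq_bigr => i _.
rewrite scalerA [c * _]mulrC -scalerA -scalerDr; congr (_ *: _).
pose q0 : 'I_n.+1 := Ordinal (ltn_pmod i (ltn0Sn n)).
have [q Dp|Dp] := unliftP i p.
  have faceE z : hoch_face i (ffset t p z) =
      ffset (hoch_face i t) q (if q == q0 then t i * z else z).
    apply/ffunP => j; rewrite !ffunE Dp (inj_eq lift_inj).
    rewrite (negPf (neq_lift i q)).
    by case: (eqVneq j q) => [->|//].
  rewrite !faceE; case: eqP => _; last exact: mtens_multilinear.
  by rewrite mulrDr -scalerAr; exact: mtens_multilinear.
have faceE z : hoch_face i (ffset t p z) =
    ffset (hoch_face i t) q0 (z * t (fintype.lift i q0)).
  apply/ffunP => j; rewrite !ffunE Dp eqxx ![fintype.lift i _ == i]eq_sym.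
  rewrite !(negPf (neq_lift i _)).
  by have -> : (j == (i %% n.+1)%N :> nat) = (j == q0) by []; case: eqP => // ->.
by rewrite !faceE mulrDl -scalerAl; exact: mtens_multilinear.
Qed.

Definition hoch_diff_succ n : hoch_chain A n.+1 -> hoch_chain A n :=
  tensor_power_lift (@hoch_bound_multilinear n).
HB.instance Definition _ n := GRing.Linear.on (@hoch_diff_succ n).

Lemma hoch_face_face n (i : 'I_n.+2) (j : 'I_n.+3) (i' : 'I_n.+3) (j' : 'I_n.+2)
    (t : {ffun 'I_n.+3 -> A}) :
  i' = i :> nat -> j = j'.+1 :> nat -> (i <= j')%N ->
  hoch_face i (hoch_face j t) = hoch_face j' (hoch_face i' t).
Proof.
move=> Di Dj lij; apply/ffunP => l; rewrite !ffunE.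
pose T m := t (inord m).
have TE x : t x = T x by rewrite /T inord_val.
rewrite !TE /= Di Dj /bump.
have modE (a b : nat) : (a <= b.+1)%N -> (a %% b.+1)%N = if a == b.+1 then 0%N else a.
  by move=> ab; case: eqP => [->|ne]; rewrite ?modnn // modn_small; lia.
have := ltn_ord i; have := ltn_ord j; have := ltn_ord i'; have := ltn_ord j'.
have := ltn_ord l; rewrite Dj Di => Hl Hj' Hi' Hj Hi.
rewrite !modE; try lia.
move: (nat_of_ord i) (nat_of_ord j') (nat_of_ord l) Hl Hj' Hi' Hj Hi lij => a b c Hl Hj' Hi' Hj Hi lij {Di Dj}.
rewrite eqSS (_ : (a == n.+2) = false); last by lia.
have [ac|ac] := leqP a c; have [bc|bc] := leqP b c; rewrite ?add0n ?add1n; try (exfalso; lia).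
all: have [Ea|Ea] := eqVneq a n.+1; have [Eb|Eb] := eqVneq b n.+1; try (exfalso; lia).
all: rewrite /=.
all: repeat (match goal with |- context [(?x <= ?y)%N] => 
   let e := fresh in have [e|e] := leqP x y; try (exfalso; lia) end); rewrite ?add0n ?add1n.
all: repeat (match goal with |- context [if ?x == ?y then _ else _] => 
   let e := fresh in have [e|e] := eqVneq x y; try (exfalso; lia) end).
all: rewrite -?mulrA.
all: try (congr (T _ * (T _ * T _)); lia); try (congr (T _ * T _); lia); try (congr (T _); lia).
all: rewrite ?mulrA; try (congr (T _ * T _ * T _); lia).
Qed.

Lemma hoch_diff_succE n (t : {ffun 'I_n.+2 -> A}) :
  hoch_diff_succ (mtens t : hoch_chain A n.+1) = hoch_bound t.
Proof. exact: tensor_power_liftE. Qed.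

Lemma hoch_diff_diff n (x : hoch_chain A n.+2) :
  hoch_diff_succ (hoch_diff_succ x) = 0.
Proof.
pose f : {linear _ -> _} := @hoch_diff_succ n \o @hoch_diff_succ n.+1.
apply: (@tensor_power_ext _ _ _ _ f \0) => t.
transitivity (hoch_diff_succ (hoch_bound t));
  first by congr (@hoch_diff_succ n _); exact: hoch_diff_succE.
rewrite /hoch_bound linear_sum /=.
rewrite (eq_bigr (fun j : 'I_n.+3 => (-1) ^+ j *: hoch_bound (hoch_face j t)));
  last by move=> j _; rewrite linearZ; congr (_ *: _); exact: hoch_diff_succE.
under eq_bigr => j _ do rewrite /hoch_bound scaler_sumr.
under eq_bigr => j _ do under eq_bigr => i _ do rewrite scalerA -exprD.
pose F (j i : nat) : hoch_chain A n := (-1) ^+ (j + i) *: mtens (hoch_face (inord i : 'I_n.+2) (hoch_face (inord j : 'I_n.+3) t)).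
transitivity (\sum_(j < n.+3) \sum_(i < n.+2) F j i).
  by apply: eq_bigr => j _; apply: eq_bigr => i _; rewrite /F !inord_val.
apply: sum_cancel => i j ltij lejn; rewrite /F.
rewrite (@hoch_face_face _ _ _ (inord i) (inord j.-1)) ?inordK; try lia.
by rewrite -scaleN1r scalerA mulrC -exprSr; congr (_ ^+ _ *: _); lia.
Qed.

Definition hoch_diff n : {linear hoch_chain A n -> hoch_chain A n.-1} :=
  match n with
  | 0 => \0
  | n'.+1 => @hoch_diff_succ n'
  end.

Definition HH (n : nat) : lmodType k := homology (hoch_diff n.+1) (hoch_diff n).
End Hochschild.

Arguments hoch_diff_succ : simpl never.

Section SingularEquivalence.
Variables (k : fieldType) (A B : algType k).

Record sing_equiv_level (n : nat) (M : bimodType A B) (N : bimodType B A) : Prop := {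
  sel_fgM : finitely_generated M;
  sel_fgN : finitely_generated N;
  sel_projM_left : projective (left_module M);
  sel_projM_right : projective (right_module M);
  sel_projN_left : projective (left_module N);
  sel_projN_right : projective (right_module N);
  sel_MN : exists2 K : bimodType A A, is_syzygy n (regular_bimodule A) K &
    stably_isomorphic (tensor_over M N) K;
  sel_NM : exists2 K : bimodType B B, is_syzygy n (regular_bimodule B) K &
    stably_isomorphic (tensor_over N M) K }.
End SingularEquivalence.

(* Main.v *)
From HB Require Import structures.
From mathcomp Require Import all_boot all_order all_algebra all_field.
From mathcomp Require Import boolp zify.
Require Import Defs.

Set Implicit Arguments.
Unset Strict Implicit.
Unset Printing Implicit Defensive.

Import GRing.Theory.
Local Open Scope ring_scope.

(** A bimodule X over A and B that is finitely generated projective as a right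
    B-module induces a transfer HH_i(A) -> HH_i(B).  A right dual basis
    (x_l, phi_l) of X turns the left action of A into a multiplicative map
    rho from A to matrices over B, rho(a) = (phi_l(a x_m)), and the transfer is
    induced by the generalised trace: a_0 (x) ... (x) a_n goes to the sum,
    over all cyclic sequences of indices, of
      phi(a_0 x) (x) phi(a_1 x) (x) ... (x) phi(a_n x).
    More generally a bimodule endomorphism e of X may be inserted in slot 0;
    write T_X(e) for the result, and T_X for T_X(id).  The theorem follows from
    five properties of these chain maps, in positive degree and up to boundaries
    on cycles.

    - Trace property (bimod_transfer_commute): T_X(gf) = T_Y(fg) for bimodule
      maps f : X -> Y and g : Y -> X.  Both sides are the two ways of
      multiplying slot 0 by one fixed matrix that commutes with rho, and
      they differ by an inner derivation, which is null-homotopic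
      (insert_homotopy).  In particular T_X does not depend on the dual basis
      and is invariant under isomorphism.
    - Additivity (bimod_transfer_split): T_P = T_L + T_Y for an extension P of
      Y by L, because in an adapted dual basis the matrices are block triangular
      and a closed path cannot return from one block to the other.
    - Vanishing (transfer_through_projective): T_X(vu) = 0 when vu factors
      through a finitely presented projective bimodule.  By the trace property
      it is enough to treat a free bimodule of finite rank.  There the matrices
      rho(a) have scalar entries, so the values of the transfer are of the form
      b (x) 1 (x) ... (x) 1.  A chain of this form is a boundary in odd degree,
      and is zero in positive even degree if it is a cycle.
    - Composition (bimod_transfer_tensor): T_(M (x)_B N) = T_N T_M, already on
      chains.
    - Normalisation (bimod_transfer_regular): T_A is the identity.

    Vanishing and additivity give T_K = (-1)^n T_A = (-1)^n for an n-th syzygy K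
    of A (syzygy_transfer), and vanishing and the trace property make T
    invariant under stable isomorphism (stably_isomorphic_transfer).
    Hence M (x)_B N, which is stably isomorphic to K, yields T_N T_M = (-1)^n on
    HH_i(A) for i > 0.  Exchanging the roles of A and B gives T_M T_N = (-1)^n,
    so T_M is an isomorphism. *)

(** * Cyclic faces and insertions *)

Section Faces.
Variables (T : Type) (mul : T -> T -> T).

(** The formula of hoch_face for an arbitrary binary operation, so that it also
    applies to tuples of matrices, which do not form an algebra over the base
    field when the index type is empty. *)
Definition face n (i : 'I_n.+2) (t : {ffun 'I_n.+2 -> T}) : {ffun 'I_n.+1 -> T} :=
  [ffun j : 'I_n.+1 =>
    if j == (i %% n.+1)%N :> nat then mul (t i) (t (fintype.lift i j))
    else t (fintype.lift i j)].

(** The new entry lands just after entry i, hence never in slot 0, which in the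
    Hochschild complex plays the role of the coefficient slot. *)
Definition insert n (i : 'I_n.+1) v (t : {ffun 'I_n.+1 -> T}) : {ffun 'I_n.+2 -> T} :=
  [ffun j : 'I_n.+2 => if j == i.+1 :> nat then v else t (inord (unbump i.+1 j))].

Definition upd n (t : {ffun 'I_n -> T}) (i : 'I_n) (x : T) : {ffun 'I_n -> T} :=
  [ffun j => if j == i then x else t j].

Ltac ord_cases :=
  repeat (match goal with
   | |- context [(?x <= ?y)%N] =>
      let e := fresh in have [e|e] := leqP x y; try (exfalso; lia)
   | |- context [if ?x == ?y then _ else _] =>
      lazymatch y with context [if _ then _ else _] => fail | _ => idtac end;
      let e := fresh in have [e|e] := eqVneq x y; try (exfalso; lia)
   end; rewrite ?add0n ?add1n /=).

Lemma modnS_wrap (a b : nat) : (a <= b.+1)%N -> (a %% b.+1)%N = if a == b.+1 then 0%N else a.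
Proof. by move=> ab; case: eqP => [->|ne]; rewrite ?modnn // modn_small; lia. Qed.

(** The next four lemmas are the simplicial identities between faces and
    insertions: the two faces adjacent to the new entry multiply it into one of
    its neighbours, and every other face commutes with the insertion up to a
    shift of indices. *)
Lemma face_insert_eq n (i : 'I_n.+1) (j : 'I_n.+2) v t :
  j = i :> nat -> face j (insert i v t) = upd t i (mul (t i) v).
Proof.
move=> Dj; apply/ffunP => l; rewrite !ffunE.
have TE x : t x = t (inord x) by rewrite inord_val.
rewrite [t i]TE [t l]TE /= -val_eqE /= modnS_wrap; last by have := ltn_ord j; lia.
have := ltn_ord l; have := ltn_ord j; have := ltn_ord i.
rewrite /bump /unbump Dj; move: (nat_of_ord l) (nat_of_ord i) => a b {Dj TE} Hb _ Ha.
ord_cases; try (congr (mul (t (inord _)) _)); try congr (t (inord _)); lia.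
Qed.

Lemma face_insert_succ n (i i' : 'I_n.+1) (j : 'I_n.+2) v t :
  j = i.+1 :> nat -> i' = (i.+1 %% n.+1)%N :> nat ->
  face j (insert i v t) = upd t i' (mul v (t i')).
Proof.
move=> Dj Di'; apply/ffunP => l; rewrite !ffunE.
have TE x : t x = t (inord x) by rewrite inord_val.
have := ltn_ord l; have := ltn_ord j; have := ltn_ord i.
rewrite [t i']TE [t l]TE /= -val_eqE /= Di' Dj => Hb _ Ha.
rewrite !modnS_wrap; last by lia.
rewrite /bump /unbump; move: (nat_of_ord l) (nat_of_ord i) Ha Hb => a b {Di' TE Dj} Ha Hb.
ord_cases; try congr (mul v (t (inord _))); try congr (t (inord _)); lia.
Qed.

Lemma face_insert_lt n (i : 'I_n.+2) (i' : 'I_n.+1) (j : 'I_n.+3) (j' : 'I_n.+2) v t :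
  i = i'.+1 :> nat -> j = j' :> nat -> (j' <= i')%N ->
  face j (insert i v t) = insert i' v (face j' t).
Proof.
move=> Di Dj lji; apply/ffunP => l; rewrite !ffunE.
have TE x : t x = t (inord x) by rewrite inord_val.
have := ltn_ord l; have := ltn_ord j'; have := ltn_ord i'.
rewrite ![t j']TE ![t (lift _ _)]TE /= Di Dj => Hi Hj Hl.
rewrite !modnS_wrap; try lia.
rewrite /bump /unbump; case: (eqVneq (nat_of_ord l) i'.+1) => El.
  by rewrite El; move: (nat_of_ord i') (nat_of_ord j') lji Hi Hj {Hl El Di Dj TE} => b c; ord_cases.
rewrite inordK; last by lia.
move: El; move: (nat_of_ord l) (nat_of_ord i') (nat_of_ord j') lji Hi Hj Hl
  => a b c {Di Dj TE} H1 H2 H3 H4 H5.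
ord_cases; try congr (mul (t (inord _)) (t (inord _)));  try congr (t (inord _)); lia.
Qed.

Lemma face_insert_gt n (i : 'I_n.+2) (i' : 'I_n.+1) (j : 'I_n.+3) (j' : 'I_n.+2) v t :
  i = i' :> nat -> j = j'.+1 :> nat -> (i' < j')%N ->
  face j (insert i v t) = insert i' v (face j' t).
Proof.
move=> Di Dj lji; apply/ffunP => l; rewrite !ffunE.
have TE x : t x = t (inord x) by rewrite inord_val.
have := ltn_ord l; have := ltn_ord j'; have := ltn_ord i'.
rewrite ![t j']TE ![t (lift _ _)]TE /= Di Dj => Hi Hj Hl.
rewrite !modnS_wrap; try lia.
rewrite /bump /unbump; case: (eqVneq (nat_of_ord l) i'.+1) => El.
  by rewrite El; move: (nat_of_ord i') (nat_of_ord j') lji Hi Hj {Hl El Di Dj TE} => b c; ord_cases.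
rewrite inordK; last by lia.
move: El; move: (nat_of_ord l) (nat_of_ord i') (nat_of_ord j') lji Hi Hj Hl
  => a b c {Di Dj TE} H1 H2 H3 H4 H5.
ord_cases; try congr (mul (t (inord _)) (t (inord _)));  try congr (t (inord _)); lia.
Qed.

(** The sign bookkeeping of a presimplicial homotopy: away from the
    diagonal and the subdiagonal, P cancels against Q. *)
Lemma sum_homotopy (V : zmodType) (P Q : nat -> nat -> V) m :
    (forall j i, (j <= i)%N -> (i < m)%N -> P j i.+1 = - Q j i) ->
    (forall j i, (i < j)%N -> (j <= m)%N -> P j.+1 i = - Q j i) ->
  \sum_(j < m.+2) \sum_(i < m.+1) P j i + \sum_(j < m.+1) \sum_(i < m) Q j i =
  \sum_(i < m.+1) (P i i + P i.+1 i).
Proof.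
elim: m => [|m IH] Plt Pgt.
  rewrite !big_ord_recl !big_ord0 /= !addr0 //.
have EP : \sum_(j < m.+3) \sum_(i < m.+2) P j i =
    \sum_(j < m.+2) \sum_(i < m.+1) P j i + (\sum_(j < m.+1) P j m.+1 + P m.+1 m.+1)
    + (\sum_(i < m.+1) P m.+2 i + P m.+2 m.+1).
  rewrite big_ord_recr /= [X in _ + X]big_ord_recr /=; congr (_ + _).
  under eq_bigr => j _ do rewrite big_ord_recr.
  by rewrite big_split /= [X in _ + X]big_ord_recr.
have EQ : \sum_(j < m.+2) \sum_(i < m.+1) Q j i =
    \sum_(j < m.+1) \sum_(i < m) Q j i + \sum_(j < m.+1) Q j m
    + \sum_(i < m.+1) Q m.+1 i.
  rewrite big_ord_recr /=; congr (_ + _).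
  by under eq_bigr => j _ do rewrite big_ord_recr; rewrite big_split.
have -> : \sum_(i < m.+2) (P i i + P i.+1 i) =
    \sum_(i < m.+1) (P i i + P i.+1 i) + (P m.+1 m.+1 + P m.+2 m.+1).
  by rewrite big_ord_recr.
rewrite EP EQ -IH; [|by move=> j i ? ?; apply: Plt; lia|by move=> j i ? ?; apply: Pgt; lia].
have -> : \sum_(j < m.+1) P j m.+1 = \sum_(j < m.+1) - Q j m.
  by apply: eq_bigr => j _; apply: Plt => //; have := ltn_ord j; lia.
have -> : \sum_(i < m.+1) P m.+2 i = \sum_(i < m.+1) - Q m.+1 i.
  by apply: eq_bigr => i _; apply: Pgt => //; have := ltn_ord i; lia.
rewrite !sumrN; move: (\sum_(j < m.+2) _) (\sum_(j < m.+1) \sum_(i < m) _).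
move: (\sum_(j < m.+1) Q j m) (\sum_(i < m.+1) Q m.+1 i) => c d a b.
move: (P m.+1 m.+1) (P m.+2 m.+1) => e f.
rewrite [LHS](AC ((1*2)*2*3) ((1*6)*(3*5)*(2*7)*(4*8)))/=.
by rewrite [- c + c]addNr [- d + d]addNr !addr0.
Qed.

(** Inner derivations act trivially on Hochschild homology: the alternating
    sum of the insertions of v is a homotopy from zero to the derivation [-, v].  It is stated
    for tuples, with an arbitrary function G in place of the class of a tensor,
    because the cancellation takes place before any linearity is used. *)
Lemma insert_homotopy (R : pzRingType) (V : lmodType R) n
    (G : {ffun 'I_n.+2 -> T} -> V) (v : T) (t : {ffun 'I_n.+2 -> T}) :
  \sum_(j < n.+3) \sum_(i < n.+2) (-1) ^+ (j + i) *: G (face j (insert i v t))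
  + \sum_(j < n.+2) \sum_(i < n.+1) (-1) ^+ (j + i) *: G (insert i v (face j t))
  = \sum_(i < n.+2) (G (upd t i (mul (t i) v)) - G (upd t i (mul v (t i)))).
Proof.
pose P j i := (-1) ^+ (j + i) *: G (face (inord j : 'I_n.+3) (insert (inord i : 'I_n.+2) v t)).
pose Q j i := (-1) ^+ (j + i) *: G (insert (inord i : 'I_n.+1) v (face (inord j : 'I_n.+2) t)).
transitivity (\sum_(j < n.+3) \sum_(i < n.+2) P j i
              + \sum_(j < n.+2) \sum_(i < n.+1) Q j i).
  by congr (_ + _); apply: eq_bigr => j _; apply: eq_bigr => i _; rewrite /P /Q !inord_val.
rewrite sum_homotopy => [|j i lji lin|j i lij ljn].
- rewrite sumrB big_split /=; congr (_ + _).
    apply: eq_bigr => i _; rewrite /P addnn -mul2n exprM sqrrN expr1n expr1n scale1r.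
    by rewrite inord_val (@face_insert_eq _ i) ?inordK //; have := ltn_ord i; lia.
  rewrite -sumrN [RHS](reindex_inj (@ordS_inj n.+2)) /=.
  apply: eq_bigr => i _; rewrite /P addSn addnn -mul2n exprS exprM sqrrN !expr1n mulr1 scaleN1r.
  by rewrite inord_val (@face_insert_succ _ i (ordS i)) ?inordK //; have := ltn_ord i; lia.
- rewrite /P /Q addnS exprS mulN1r scaleNr (@face_insert_lt _ _ (inord i) _ (inord j)) //;
  by rewrite !inordK //; lia.
- rewrite /P /Q addSn exprS mulN1r scaleNr (@face_insert_gt _ _ (inord i) _ (inord j)) //;
  by rewrite !inordK //; lia.
Qed.
End Faces.

(** * Traces of tuples of matrices *)

Section Multilinear.
Variables (k : fieldType) (V W : lmodType k) (m : nat).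
Variables (f : {ffun 'I_m -> V} -> W) (fm : multilinear f).

Lemma multilinear0 t p : f (ffset t p 0) = 0.
Proof. by have := fm t p (-1) 0 0; rewrite scaler0 addr0 scaleN1r addNr. Qed.

Lemma multilinearD t p x y : f (ffset t p (x + y)) = f (ffset t p x) + f (ffset t p y).
Proof. by have := fm t p 1 x y; rewrite !scale1r. Qed.

Lemma multilinearZ t p c x : f (ffset t p (c *: x)) = c *: f (ffset t p x).
Proof. by have := fm t p c x 0; rewrite multilinear0 !addr0. Qed.

Lemma multilinear_sum t p (L : finType) (x : L -> V) :
  f (ffset t p (\sum_l x l)) = \sum_l f (ffset t p (x l)).
Proof.
apply: (big_morph (fun y => f (ffset t p y))); [exact: multilinearD|exact: multilinear0].
Qed.
End Multilinear.

Lemma val_ord_pred n (i : 'I_n.+1) : ord_pred i = (if i == 0 :> nat then n else i.-1) :> nat.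
Proof.
case: i => -[|i] lti /=; first by rewrite modn_small.
rewrite modnDr modn_small; [by []|exact: ltnW].
Qed.

Lemma lift_bumpE n (i : 'I_n.+1) (j : 'I_n) : fintype.lift i j = bump i j :> nat.
Proof. by []. Qed.

(** Deleting slot i from a cyclic word: how the cyclic predecessor interacts with
    the relabelling of the remaining slots.  Here q is the slot in which
    the product of slot i and its successor lands. *)
Section OrdPred.
Variables (n : nat) (i : 'I_n.+2) (q : 'I_n.+1).
Hypothesis Dq : q = (i %% n.+1)%N :> nat.

Lemma face_indexE : q = (if i == n.+1 :> nat then 0%N else i) :> nat.
Proof. by rewrite Dq modnS_wrap //; exact: (ltn_ord i). Qed.

Lemma ord_pred_lift_next : ord_pred (fintype.lift i q) = i.
Proof.
apply: ord_inj; rewrite val_ord_pred lift_bumpE face_indexE.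
have := ltn_ord i; move: (nat_of_ord i) => a Ha.
by rewrite /bump; case: (eqVneq a n.+1) => ? /=; do ?[case: ifP => ? /=]; lia.
Qed.

Lemma ord_pred_lift_prev : ord_pred i = fintype.lift i (ord_pred q).
Proof.
apply: ord_inj; rewrite lift_bumpE !val_ord_pred face_indexE.
have := ltn_ord i; move: (nat_of_ord i) => a Ha.
by rewrite /bump; case: (eqVneq a n.+1) => ? /=; do ?[case: ifP => ? /=]; lia.
Qed.

Lemma ord_pred_lift j : j != q -> ord_pred (fintype.lift i j) = fintype.lift i (ord_pred j).
Proof.
rewrite -(inj_eq (@ord_inj _)) face_indexE => nej.
apply: ord_inj; rewrite lift_bumpE !val_ord_pred lift_bumpE.
have := ltn_ord i; have := ltn_ord j; move: (nat_of_ord i) (nat_of_ord j) nej => a b nej Hb Ha.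
by move: nej; rewrite /bump; case: (eqVneq a n.+1) => ? /=; do ?[case: ifP => ? /=]; lia.
Qed.
End OrdPred.

Section PathTrace.
Variables (k : fieldType) (B : algType k) (I : finType).
Notation mat := (I -> I -> B).

Definition mat_mul (X Y : mat) : mat := fun a b => \sum_l X a l * Y l b.

(** An index function g labels the vertices of a cycle whose edges are the
    slots; slot j joins the vertex of its predecessor to its own vertex. *)
Definition path_entries n (W : {ffun 'I_n.+1 -> mat}) (g : {ffun 'I_n.+1 -> I}) :
    {ffun 'I_n.+1 -> B} :=
  [ffun j => W j (g (ord_pred j)) (g j)].

Lemma path_entriesE n (W : {ffun 'I_n.+1 -> mat}) g j :
  path_entries W g j = W j (g (ord_pred j)) (g j).
Proof. exact: ffunE. Qed.

(** The generalised trace from Hochschild chains on matrices over B to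
    Hochschild chains on B. *)
Definition path_trace n (W : {ffun 'I_n.+1 -> mat}) : hoch_chain B n :=
  \sum_g mtens (path_entries W g).

Lemma path_trace_linear n (W : {ffun 'I_n.+1 -> mat}) p c (X Y Z : mat) :
    (forall a b, Z a b = c *: X a b + Y a b) ->
  path_trace (upd W p Z) = c *: path_trace (upd W p X) + path_trace (upd W p Y).
Proof.
move=> DZ; rewrite /path_trace scaler_sumr -big_split /=; apply: eq_bigr => g _.
have E X' : path_entries (upd W p X') g = ffset (path_entries W g) p (X' (g (ord_pred p)) (g p)).
  by apply/ffunP => j; rewrite !ffunE; case: eqVneq => [->|].
by rewrite !E DZ; exact: mtens_multilinear.
Qed.

(** Merging slot i with its successor forgets the vertex between them, and
    the sum over that vertex is the matrix product, so the generalised trace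
    commutes with every face. *)
Lemma hoch_diff_path_trace n (W : {ffun 'I_n.+2 -> mat}) :
  hoch_diff B n.+1 (path_trace W) = \sum_(i < n.+2) (-1) ^+ i *: path_trace (face mat_mul i W).
Proof.
rewrite /= linear_sum /=.
under eq_bigr => g _ do rewrite hoch_diff_succE /hoch_bound.
rewrite exchange_big /=; apply: eq_bigr => i _; rewrite -scaler_sumr; congr (_ *: _).
pose q0 : 'I_n.+1 := Ordinal (ltn_pmod i (ltn0Sn n)).
(* A labelling of n.+2 slots is the label of slot i and a labelling of the rest. *)
pose join (lg : I * {ffun 'I_n.+1 -> I}) : {ffun 'I_n.+2 -> I} :=
  [ffun j => if unlift i j is Some j' then lg.2 j' else lg.1].
rewrite (reindex join) /=; last first.
  exists (fun g => (g i, [ffun j' => g (fintype.lift i j')])) => [[l g] _|g _].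
    rewrite /join ffunE unlift_none /=; congr (_, _).
    by apply/ffunP => j; rewrite !ffunE liftK.
  by apply/ffunP => j; rewrite /join ffunE; case: unliftP => [j' ->|-> //]; rewrite ffunE.
rewrite -(pair_bigA _ (fun l g => mtens (hoch_face i (path_entries W (join (l, g)))))) /=.
rewrite exchange_big /path_trace; apply: eq_bigr => g _.
have joinl l j : join (l, g) (fintype.lift i j) = g j by rewrite ffunE liftK.
have joini l : join (l, g) i = l by rewrite ffunE unlift_none.
pose x l := W i (g (ord_pred q0)) l * W (fintype.lift i q0) l (g q0).
have De l : hoch_face i (path_entries W (join (l, g))) =
    ffset (path_entries (face mat_mul i W) g) q0 (x l).
  apply/ffunP => j; rewrite [LHS]ffunE [RHS]ffunE !path_entriesE.
  rewrite -[(i %% n.+1)%N]/(val q0) val_eqE; case: (eqVneq j q0) => [->|ne].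
    by rewrite /x joini joinl ord_pred_lift_next // joini (@ord_pred_lift_prev _ _ q0) // joinl.
  by rewrite (@ord_pred_lift _ _ q0) // !joinl ffunE -[(i %% n.+1)%N]/(val q0) val_eqE (negPf ne).
under eq_bigr => l _ do rewrite De.
rewrite -(multilinear_sum (@mtens_multilinear _ _ _)); congr mtens.
apply/ffunP => j; rewrite !ffunE -[(i %% n.+1)%N]/(val q0) val_eqE.
by case: (eqVneq j q0) => [->|//].
Qed.
End PathTrace.

(** * Block-triangular tuples *)

Section BlockTrace.
Variables (k : fieldType) (B : algType k) (I J : finType) (n : nat).
Variables (W : {ffun 'I_n.+1 -> I + J -> I + J -> B}).
Hypothesis W_triangular : forall p a b, W p (inr b) (inl a) = 0.

(** A set of slots that is closed under the cyclic successor is empty or full. *)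
Lemma cyclic_closed (P : pred 'I_n.+1) :
  (forall j, P (ord_pred j) -> P j) -> forall i j, P i -> P j.
Proof.
move=> PS i j Pi.
have up a m : P (inord a) -> (a + m < n.+1)%N -> P (inord (a + m)).
  elim: m => [|m IH] Pa lam; first by rewrite addn0.
  apply: PS; rewrite (_ : ord_pred _ = inord (a + m)); first by apply: IH => //; lia.
  by apply: ord_inj; rewrite val_ord_pred !inordK; try lia; rewrite addnS.
have P0 : P (inord 0).
  apply: PS; rewrite (_ : ord_pred _ = inord (i + (n - i))).
    by apply: up; rewrite ?inord_val //; have := ltn_ord i; lia.
  by apply: ord_inj; rewrite val_ord_pred !inordK //=; have := ltn_ord i; lia.
by have := up 0%N j P0; rewrite add0n inord_val; apply; exact: ltn_ord.
Qed.

(** A closed path that visits both blocks uses an edge from the second block to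
    the first, whose entry is zero. *)
Lemma path_trace_block :
  path_trace W = path_trace [ffun p => fun a b => W p (inl a) (inl b)]
               + path_trace [ffun p => fun a b => W p (inr a) (inr b)].
Proof.
pose hl (g : {ffun 'I_n.+1 -> I}) : {ffun 'I_n.+1 -> I + J} := [ffun j => inl (g j)].
pose hr (g : {ffun 'I_n.+1 -> J}) : {ffun 'I_n.+1 -> I + J} := [ffun j => inr (g j)].
have hlI : injective hl.
  by move=> g g' /ffunP gg'; apply/ffunP => j; have := gg' j; rewrite !ffunE => -[].
have hrI : injective hr.
  by move=> g g' /ffunP gg'; apply/ffunP => j; have := gg' j; rewrite !ffunE => -[].
have inlP (g : {ffun 'I_n.+1 -> I + J}) : (forall j, is_inl (g j)) -> g \in hl @: setT.
  move=> gl; have /fin_all_exists[g' Dg'] j : exists a, g j = inl a.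
    by case: (g j) (gl j) => // a; exists a.
  by apply/imsetP; exists [ffun j => g' j]; rewrite ?inE //; apply/ffunP => j; rewrite !ffunE.
have inrP (g : {ffun 'I_n.+1 -> I + J}) : (forall j, ~~ is_inl (g j)) -> g \in hr @: setT.
  move=> gl; have /fin_all_exists[g' Dg'] j : exists a, g j = inr a.
    by case: (g j) (gl j) => // a; exists a.
  by apply/imsetP; exists [ffun j => g' j]; rewrite ?inE //; apply/ffunP => j; rewrite !ffunE.
rewrite {1}/path_trace (bigID (fun g => g \in hl @: setT)) /=; congr (_ + _).
  rewrite big_imset /=; last by move=> x y _ _; exact: hlI.
  apply: eq_big => [g|g _]; [exact: in_setT|congr mtens].
  by apply/ffunP => j; rewrite !ffunE.
rewrite (bigID (fun g => g \in hr @: setT)) /= [X in _ + X]big1 ?addr0; last first.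
  move=> g /andP[gl gr].
  have [j Dj] : exists j, ~~ is_inl (g (ord_pred j)) && is_inl (g j).
    apply/existsP; apply: contraT; rewrite negb_exists => /forallP nog.
    have closed j : ~~ is_inl (g (ord_pred j)) -> ~~ is_inl (g j).
      by move=> gj; have := nog j; rewrite gj.
    have all_r := cyclic_closed closed.
    have [/existsP[j gj]|] := boolP [exists j, ~~ is_inl (g j)].
      by case/negP: gr; apply: inrP => i; exact: all_r gj.
    by rewrite negb_exists => /forallP gl'; case/negP: gl; apply: inlP => j; have := gl' j; rewrite negbK.
  rewrite (_ : path_entries W g = ffset (path_entries W g) j 0).
    by rewrite (multilinear0 (@mtens_multilinear _ _ _)).
  apply/ffunP => i; rewrite [RHS]ffunE; case: eqVneq => // ->; rewrite path_entriesE.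
  by case/andP: Dj; case: (g (ord_pred j)) => // b _; case: (g j) => // a _; exact: W_triangular.
rewrite (eq_bigl (fun g => g \in hr @: setT)) => [|g]; last first.
  rewrite andb_idl // => /imsetP[g' _ ->]; apply/negP => /imsetP[g'' _ /ffunP/(_ ord0)].
  by rewrite !ffunE.
rewrite big_imset /=; last by move=> x y _ _; exact: hrI.
apply: eq_big => [g|g _]; [exact: in_setT|congr mtens].
by apply/ffunP => j; rewrite !ffunE.
Qed.
End BlockTrace.

(** * The transfer of a matrix representation *)
Section Transfer.
Variables (k : fieldType) (A B : algType k).

Definition homologous n (f g : hoch_chain A n -> hoch_chain B n) : Prop :=
  forall z, hoch_diff A n z = 0 ->
    exists w : hoch_chain B n.+1, f z - g z = hoch_diff B n.+1 w.

Section Rep.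
Variable I : finType.
Notation mat := (I -> I -> B).

Definition entrywise_linear (s : A -> mat) := forall a b, linear (fun x => s x a b).

(** The coefficient slot 0 has its own map s, into which an endomorphism of
    the bimodule can be absorbed. *)
Definition slots (s r : A -> mat) n (t : {ffun 'I_n.+1 -> A}) : {ffun 'I_n.+1 -> mat} :=
  [ffun j => if j == ord0 then s (t j) else r (t j)].

(** r is a representation of A and s a map of A-bimodules to matrices with the
    actions given by r.  The representation of a dual basis is non-unital: r(1)
    is the idempotent matrix (phi_l(x_m)), in general not the identity. *)
Definition bimodule_like (s r : A -> mat) : Prop :=
  [/\ forall a b, r (a * b) = mat_mul (r a) (r b),
      forall a b, s (a * b) = mat_mul (s a) (r b)
    & forall a b, s (a * b) = mat_mul (r a) (s b)].

Lemma face_slots s r n (i : 'I_n.+2) t : bimodule_like s r ->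
  face (@mat_mul _ B I) i (slots s r t) = slots s r (hoch_face i t).
Proof.
case=> rM sMr sMl; apply/ffunP => j; rewrite !ffunE.
have := ltn_ord i; have := ltn_ord j => Hj Hi.
have jE : (j == ord0) = (j == 0%N :> nat) by [].
have iE : (i == ord0) = (i == 0%N :> nat) by [].
have lE : (fintype.lift i j == ord0) = (bump i j == 0%N) by [].
rewrite jE iE lE modnS_wrap //.
case: (eqVneq (nat_of_ord i) n.+1) => [Di|nei].
  have -> : (nat_of_ord i == 0%N) = false by lia.
  have -> : (bump i j == 0%N) = (j == 0%N :> nat) by rewrite /bump; lia.
  by case: (nat_of_ord j == 0%N) => //; rewrite sMl.
have -> : (bump i j == 0%N) = (i != 0%N :> nat) && (j == 0%N :> nat) by rewrite /bump; lia.
case: (eqVneq (nat_of_ord j) i) => [Dj|nej].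
  rewrite Dj; case: (nat_of_ord i == 0%N) => /=; by rewrite ?sMr ?rM.
by case: (eqVneq (nat_of_ord i) 0%N) => //= i0; rewrite (_ : (_ == 0%N) = false) //; lia.
Qed.

Section Linear.
Variables (s r : A -> mat) (sL : entrywise_linear s) (rL : entrywise_linear r).

Lemma slots_ffset n (t : {ffun 'I_n.+1 -> A}) p x :
  slots s r (ffset t p x) = upd (slots s r t) p (if p == ord0 then s x else r x).
Proof. by apply/ffunP => j; rewrite !ffunE; case: (eqVneq j p) => [->|]. Qed.

Lemma slots_multilinear n : multilinear (fun t => path_trace (@slots s r n t)).
Proof.
move=> t p c x y; rewrite !slots_ffset; apply: path_trace_linear => a b.
by case: ifP => _; [exact: sL|exact: rL].
Qed.

Definition transfer n : hoch_chain A n -> hoch_chain B n :=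
  tensor_power_lift (@slots_multilinear n).
HB.instance Definition _ n := GRing.Linear.on (@transfer n).

Lemma transferE n t : transfer (mtens t : hoch_chain A n) = path_trace (slots s r t).
Proof. exact: tensor_power_liftE. Qed.

Hypothesis srM : bimodule_like s r.

Lemma transfer_diff n (z : hoch_chain A n.+1) :
  hoch_diff B n.+1 (transfer z) = transfer (hoch_diff A n.+1 z).
Proof.
apply: (@tensor_power_ext _ _ _ _ (hoch_diff B n.+1 \o @transfer n.+1)
         (@transfer n \o hoch_diff A n.+1)) => t.
rewrite /= transferE hoch_diff_path_trace hoch_diff_succE linear_sum /=.
by apply: eq_bigr => i _; rewrite linearZ /= transferE face_slots.
Qed.

Variable v : mat.
Hypothesis rv : forall a, mat_mul (r a) v = mat_mul v (r a).

Definition insertion n (t : {ffun 'I_n.+1 -> A}) : hoch_chain B n.+1 :=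
  \sum_(i < n.+1) (-1) ^+ i *: path_trace (insert i v (slots s r t)).

Lemma insertion_multilinear n : multilinear (@insertion n).
Proof.
move=> t p c x y; rewrite /insertion scaler_sumr -big_split /=; apply: eq_bigr => i _.
rewrite scalerA [c * _]mulrC -scalerA -scalerDr; congr (_ *: _).
have E z : insert i v (slots s r (ffset t p z)) =
    upd (insert i v (slots s r t)) (inord (bump i.+1 p)) (if p == ord0 then s z else r z).
  apply/ffunP => j; rewrite slots_ffset !ffunE.
  have := ltn_ord p; have := ltn_ord i; have := ltn_ord j => Hj Hi Hp.
  have -> : (j == inord (bump i.+1 p)) = (j == bump i.+1 p :> nat).
    by rewrite -val_eqE /= inordK // /bump; lia.
  case: (eqVneq (nat_of_ord j) i.+1) => Dj.
    by rewrite (_ : (_ == bump i.+1 p) = false) // /bump; lia.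
  rewrite (_ : (inord (unbump i.+1 j) == p) = (j == bump i.+1 p :> nat)) //.
  by rewrite -val_eqE /= inordK /bump /unbump; lia.
rewrite !E; apply: path_trace_linear => a b.
by case: ifP => _; [exact: sL|exact: rL].
Qed.

(** In the derivation [-, v] of a tuple all terms but that of slot 0 vanish,
    as v commutes with r. *)
Lemma transfer_homotopy (s1 s2 : A -> mat) :
    (forall a, s1 a = mat_mul (s a) v) -> (forall a, s2 a = mat_mul v (s a)) ->
    forall n t, path_trace (@slots s1 r n.+1 t) - path_trace (slots s2 r t) =
      hoch_diff B n.+2 (insertion t) +
      tensor_power_lift (@insertion_multilinear n) (hoch_diff A n.+1 (mtens t)).
Proof.
move=> D1 D2 n t.
have HI := insert_homotopy (@mat_mul k B I) (@path_trace _ B I n.+1) v (slots s r t).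
rewrite [in RHS]big_ord_recl [X in _ = _ + X]big1 in HI => [|i _]; last first.
  by rewrite ffunE /= rv subrr.
rewrite addr0 ffunE /= -D1 -D2 in HI; move: HI.
have E s' : upd (slots s r t) ord0 (s' (t ord0)) = slots s' r t.
  by apply/ffunP => j; rewrite !ffunE; case: eqVneq => // ->.
rewrite !E => <-; congr (_ + _).
  rewrite exchange_big /insertion linear_sum; apply: eq_bigr => i _.
  rewrite linearZ [LHS]/= hoch_diff_path_trace [RHS]scaler_sumr; apply: eq_bigr => j _.
  by rewrite scalerA -exprD addnC.
rewrite [in RHS]/= hoch_diff_succE linear_sum; apply: eq_bigr => j _.
rewrite linearZ /= tensor_power_liftE /insertion scaler_sumr; apply: eq_bigr => i _.
by rewrite scalerA -exprD face_slots.
Qed.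
End Linear.

Lemma transfer_commute s r v s1 s2 (rL : entrywise_linear r)
    (s1L : entrywise_linear s1) (s2L : entrywise_linear s2) n :
    entrywise_linear s -> bimodule_like s r ->
    (forall a, mat_mul (r a) v = mat_mul v (r a)) ->
    (forall a, s1 a = mat_mul (s a) v) -> (forall a, s2 a = mat_mul v (s a)) ->
  homologous (transfer s1L rL (n := n.+1)) (transfer s2L rL (n := n.+1)).
Proof.
move=> sL srM rv D1 D2 z dz.
pose H m := tensor_power_lift (@insertion_multilinear s r sL rL v m).
exists (H n.+1 z).
pose f := transfer s1L rL (n := n.+1) \- transfer s2L rL (n := n.+1).
pose g := (hoch_diff B n.+2 \o H n.+1) \+ (H n \o hoch_diff A n.+1).
rewrite -[LHS]/(f z).
have -> : f z = g z.
  apply: (@tensor_power_ext _ _ _ _ f g) => t.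
  rewrite /f /g /= !transferE (transfer_homotopy sL rL srM rv D1 D2).
  by rewrite /H tensor_power_liftE.
by rewrite /g /= /H dz linear0 addr0.
Qed.
End Rep.
End Transfer.

Section Homologous.
Variables (k : fieldType) (A B : algType k) (n : nat).
Implicit Types f g h : hoch_chain A n -> hoch_chain B n.

Lemma eq_homologous f g : f =1 g -> homologous f g.
Proof. by move=> fg z _; exists 0; rewrite fg subrr linear0. Qed.

Lemma homologous_sym f g : homologous f g -> homologous g f.
Proof. by move=> fg z /fg[w Dw]; exists (- w); rewrite [RHS]linearN -Dw opprB. Qed.

Lemma homologous_trans f g h : homologous f g -> homologous g h -> homologous f h.
Proof.
move=> fg gh z dz; have [w Dw] := fg z dz; have [w' Dw'] := gh z dz.
by exists (w + w'); rewrite [RHS]linearD -Dw -Dw' addrA subrK.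
Qed.
End Homologous.

(** * Right-linear maps and dual bases *)
Section RightLinear.
Variables (k : fieldType) (A B : algType k).

Lemma vspace_scale_ract (X : bimodType A B) c (x : X) :
  c *: (x : vspace_module X) = ract x c%:A.
Proof.
rewrite vspace_scaleE /ract (_ : tensop_tens c%:A 1 = tensop_tens 1 c%:A) //.
by rewrite /tensop_tens tensZl tensZr.
Qed.

Definition rlinear (X Y : bimodType A B) (h : X -> Y) : Prop :=
  {morph h : x y / x + y} /\ forall x b, h (ract x b) = ract (h x) b.

Lemma bimod_rlinear (X Y : bimodType A B) (f : {linear X -> Y}) : rlinear f.
Proof. by split=> [|x b]; [exact: linearD|rewrite /ract linearZ]. Qed.

Lemma bimod_lact (X Y : bimodType A B) (f : {linear X -> Y}) a x : f (lact a x) = lact a (f x).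
Proof. by rewrite /lact linearZ. Qed.

Lemma lact_rlinear (X : bimodType A B) a : rlinear (@lact _ _ _ X a).
Proof. by split=> [x y|x b]; [rewrite /lact scalerDr|rewrite lact_ract]. Qed.

Lemma rlinear_comp (X Y Z : bimodType A B) (g : Y -> Z) (f : X -> Y) :
  rlinear g -> rlinear f -> rlinear (fun x => g (f x)).
Proof. by case=> gD gr [fD fr]; split=> [x y|x b]; rewrite ?fD ?gD ?fr ?gr. Qed.

Lemma rlinear_sum (X Y : bimodType A B) (h : X -> Y) (I : finType) (F : I -> X) :
  rlinear h -> h (\sum_i F i) = \sum_i h (F i).
Proof.
case=> hD _; apply: (big_morph h hD).
by apply: (addrI (h 0)); rewrite -hD !addr0.
Qed.

(** A finite dual basis of X as a right B-module; its existence says that X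
    is finitely generated projective on the right. *)
Record dual_basis (X : bimodType A B) := DualBasis {
  db_index : finType;
  db_vec : db_index -> X;
  db_coord : db_index -> X -> B;
  db_coordD : forall i, {morph db_coord i : x y / x + y};
  db_coord_ract : forall i x b, db_coord i (ract x b) = db_coord i x * b;
  db_expand : forall x, x = \sum_i ract (db_vec i) (db_coord i x) }.

Arguments db_vec {X} d.
Arguments db_coord {X} d.

Lemma db_coord_sum X (dX : dual_basis X) i (I : finType) (F : I -> X) :
  db_coord dX i (\sum_l F l) = \sum_l db_coord dX i (F l).
Proof.
apply: (big_morph _ (@db_coordD _ dX i)).
by apply: (addrI (db_coord dX i 0)); rewrite -db_coordD !addr0.
Qed.

Lemma db_coordZ X (dX : dual_basis X) i c (x : vspace_module X) :
  db_coord dX i (c *: x) = c *: db_coord dX i x.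
Proof. by rewrite vspace_scale_ract db_coord_ract mulr_algr. Qed.

Definition db_mx X Y (dX : dual_basis X) (dY : dual_basis Y) (h : X -> Y) :
    db_index dY -> db_index dX -> B :=
  fun i j => db_coord dY i (h (db_vec dX j)).

Arguments db_mx {X Y} dX dY h _ _.

Lemma db_mx_comp X Y Z (dX : dual_basis X) (dY : dual_basis Y) (dZ : dual_basis Z)
    (g : Y -> Z) (f : X -> Y) i j : rlinear g ->
  db_mx dX dZ (fun x => g (f x)) i j = \sum_l db_mx dY dZ g i l * db_mx dX dY f l j.
Proof.
move=> gL; rewrite /db_mx {1}[f (db_vec dX j)](db_expand dY) rlinear_sum // db_coord_sum.
case: (gL) => _ gr; by apply: eq_bigr => l _; rewrite gr db_coord_ract.
Qed.

Arguments db_mx_comp {X Y Z} dX dY dZ g f i j.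

(** The matrix of the right B-linear map that sends x to e(ax). *)
Definition db_rep X Y (dX : dual_basis X) (dY : dual_basis Y) (e : X -> Y) (a : A) :=
  db_mx dX dY (fun x => e (lact a x)).

Arguments db_rep {X Y} dX dY e a _ _.

Lemma db_rep_linear X Y (dX : dual_basis X) (dY : dual_basis Y) (e : {linear X -> Y}) i j :
  linear (fun a => db_rep dX dY e a i j).
Proof.
move=> c a a'; rewrite /db_rep /db_mx lact_linearl linearD db_coordD.
congr (_ + _); rewrite vspace_scale_ract.
by case: (bimod_rlinear e) => _ ->; rewrite db_coord_ract mulr_algr.
Qed.

Lemma db_rep_comp X Y Z (dX : dual_basis X) (dY : dual_basis Y) (dZ : dual_basis Z)
    (g : {linear Y -> Z}) (f : {linear X -> Y}) a b i j :
  db_rep dX dZ (fun x => g (f x)) (a * b) i j =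
  \sum_l db_rep dY dZ g a i l * db_rep dX dY f b l j.
Proof.
rewrite -(db_mx_comp dX dY dZ (fun y => g (lact a y)) (fun x => f (lact b x))).
  by rewrite /db_rep /db_mx lactM -bimod_lact.
exact: rlinear_comp (bimod_rlinear g) (lact_rlinear _ _).
Qed.

Arguments db_rep_comp {X Y Z} dX dY dZ g f a b i j.

Section Transfer.
Variables (X : bimodType A B) (dX : dual_basis X).

Lemma db_rep_entrywise_linear (e : {linear X -> X}) : entrywise_linear (db_rep dX dX e).
Proof. by move=> i j; exact: db_rep_linear. Qed.

Lemma db_rep_bimodule_like (e : {linear X -> X}) :
  bimodule_like (db_rep dX dX e) (db_rep dX dX idfun).
Proof.
split=> a b; apply/funext => i; apply/funext => j; rewrite /mat_mul.
- exact: (db_rep_comp dX dX dX idfun idfun).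
- exact: (db_rep_comp dX dX dX e idfun).
- exact: (db_rep_comp dX dX dX idfun e).
Qed.

(** The chain map T_X(e). *)
Definition bimod_transfer (e : {linear X -> X}) n : hoch_chain A n -> hoch_chain B n :=
  transfer (db_rep_entrywise_linear e) (db_rep_entrywise_linear idfun) (n := n).
HB.instance Definition _ e n := GRing.Linear.on (@bimod_transfer e n).

Lemma bimod_transferE e n t : bimod_transfer e (mtens t : hoch_chain A n) =
  path_trace (slots (db_rep dX dX e) (db_rep dX dX idfun) t).
Proof. exact: transferE. Qed.

Lemma bimod_transfer_diff e n (z : hoch_chain A n.+1) :
  hoch_diff B n.+1 (bimod_transfer e z) = bimod_transfer e (hoch_diff A n.+1 z).
Proof. exact/transfer_diff/db_rep_bimodule_like. Qed.

Lemma eq_bimod_transfer (e e' : {linear X -> X}) n : e =1 e' ->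
  @bimod_transfer e n =1 @bimod_transfer e' n.
Proof.
move=> ee'; apply: (@tensor_power_ext _ _ _ _ (@bimod_transfer e n) (@bimod_transfer e' n)) => t.
rewrite /= !bimod_transferE.
by congr (path_trace (slots _ _ _)); apply/funext => a; apply/funext => i; apply/funext => j;
  rewrite /db_rep /db_mx ee'.
Qed.

Lemma bimod_transferD (e e1 e2 : {linear X -> X}) n : (forall x, e x = e1 x + e2 x) ->
  @bimod_transfer e n =1 @bimod_transfer e1 n \+ @bimod_transfer e2 n.
Proof.
move=> De; apply: (@tensor_power_ext _ _ _ _ (@bimod_transfer e n)
   (@bimod_transfer e1 n \+ @bimod_transfer e2 n)) => t.
rewrite /= !bimod_transferE.
have E e' : slots (db_rep dX dX e') (db_rep dX dX idfun) t =
   upd (slots (db_rep dX dX idfun) (db_rep dX dX idfun) t) ord0 (db_rep dX dX e' (t ord0)).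
  by apply/ffunP => j; rewrite !ffunE; case: eqVneq => [->|].
rewrite (E e) (E e1) (E e2) -[X in X + _]scale1r; apply: path_trace_linear => i j.
by rewrite scale1r /db_rep /db_mx De db_coordD.
Qed.
End Transfer.

(** The matrices of the actions on X and on Y are put in one block-diagonal
    representation r on the sum of the two index types.  There f and g become
    off-diagonal blocks: g, absorbed in the bimodule map s, goes from Y
    to X, and v, the matrix of f, commutes with r.  The products s v and v s
    are concentrated in the blocks of X and of Y, where they
    compute gf and fg. *)
Section Commute.
Variables (X Y : bimodType A B) (dX : dual_basis X) (dY : dual_basis Y).
Variables (f : {linear X -> Y}) (g : {linear Y -> X}).
Notation I := (db_index dX + db_index dY)%type.

Let upper_block (xx : A -> db_index dX -> db_index dX -> B) xy
    (yy : A -> db_index dY -> db_index dY -> B) : A -> I -> I -> B :=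
  fun a i j => match i, j with
  | inl i, inl j => xx a i j
  | inl i, inr j => xy a i j
  | inr i, inl j => 0
  | inr i, inr j => yy a i j
  end.
Let zxx (a : A) (i j : db_index dX) : B := 0.
Let zxy (a : A) (i : db_index dX) (j : db_index dY) : B := 0.
Let zyy (a : A) (i j : db_index dY) : B := 0.
Let r := upper_block (db_rep dX dX idfun) zxy (db_rep dY dY idfun).
Let s := upper_block zxx (db_rep dY dX g) zyy.
Let v : I -> I -> B := fun i j =>
  match i, j with inr i, inl j => db_mx dX dY f i j | _, _ => 0 end.

Let zero_linear : linear (fun _ : A => 0 : B).
Proof. by move=> c x y; rewrite scaler0 addr0. Qed.

Lemma upper_block_linear xx xy yy : entrywise_linear xx ->
  (forall a b, linear (fun x => xy x a b)) -> entrywise_linear yy ->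
  entrywise_linear (upper_block xx xy yy).
Proof. by move=> xxL xyL yyL [i|i] [j|j]; [exact: xxL|exact: xyL| |exact: yyL]. Qed.

Let rL : entrywise_linear r.
Proof. by apply: upper_block_linear => i j; [exact: db_rep_linear| |exact: db_rep_linear]. Qed.
Let sL : entrywise_linear s.
Proof. by apply: upper_block_linear => i j //; exact: db_rep_linear. Qed.

Let big0l (J : finType) (F : J -> B) : \sum_l 0 * F l = 0.
Proof. by rewrite big1 // => l _; rewrite mul0r. Qed.
Let big0r (J : finType) (F : J -> B) : \sum_l F l * 0 = 0.
Proof. by rewrite big1 // => l _; rewrite mulr0. Qed.

Lemma bimod_transfer_commute n :
  homologous (bimod_transfer dX (g \o f) (n := n.+1)) (bimod_transfer dY (f \o g) (n := n.+1)).
Proof.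
pose s1 := upper_block (db_rep dX dX (g \o f)) zxy zyy.
pose s2 := upper_block zxx zxy (db_rep dY dY (f \o g)).
have s1L : entrywise_linear s1 by apply: upper_block_linear => i j //; exact: db_rep_linear.
have s2L : entrywise_linear s2 by apply: upper_block_linear => i j //; exact: db_rep_linear.
have srM : bimodule_like s r.
  split=> a b; apply/funext => -[i|i]; apply/funext => -[j|j];
    rewrite /mat_mul big_sumType /= ?big0l ?big0r ?add0r ?addr0 //.
  - exact: (db_rep_comp dX dX dX idfun idfun).
  - exact: (db_rep_comp dY dY dY idfun idfun).
  - exact: (db_rep_comp dY dY dX g idfun).
  - exact: (db_rep_comp dY dX dX idfun g).
have rep_mx a i j : \sum_l db_rep dY dY idfun a i l * db_mx dX dY f l j =
                    \sum_l db_mx dX dY f i l * db_rep dX dX idfun a l j.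
  rewrite -(db_mx_comp dX dY dY) -?(db_mx_comp dX dX dY).
  + by rewrite /db_mx /= bimod_lact.
  + exact: bimod_rlinear.
  + exact: lact_rlinear.
have rv a : mat_mul (r a) v = mat_mul v (r a).
  apply/funext => -[i|i]; apply/funext => -[j|j];
  by rewrite /mat_mul !big_sumType /= ?big0l ?big0r ?add0r ?addr0.
have D1 a : s1 a = mat_mul (s a) v.
  apply/funext => -[i|i]; apply/funext => -[j|j];
    rewrite /mat_mul !big_sumType /= ?big0l ?big0r ?add0r ?addr0 //.
  rewrite -(db_mx_comp dX dY dX); last exact: rlinear_comp (bimod_rlinear g) (lact_rlinear _ _).
  by rewrite /db_rep /db_mx /= bimod_lact.
have D2 a : s2 a = mat_mul v (s a).
  apply/funext => -[i|i]; apply/funext => -[j|j];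
    rewrite /mat_mul !big_sumType /= ?big0l ?big0r ?add0r ?addr0 //.
  by rewrite -(db_mx_comp dY dX dY) //; exact: bimod_rlinear.
have block0 (J : finType) (r' : A -> J -> J -> B) t :
    path_trace (slots (fun _ _ _ => 0) r' t : {ffun 'I_n.+2 -> _}) = 0.
  rewrite /path_trace big1 // => h _.
  rewrite (_ : path_entries _ h = ffset (path_entries (slots (fun _ _ _ => 0) r' t) h) ord0 0).
    by rewrite (multilinear0 (@mtens_multilinear _ _ _)).
  by apply/ffunP => j; rewrite [RHS]ffunE path_entriesE !ffunE; case: eqVneq.
have H := transfer_commute rL s1L s2L (n := n) sL srM rv D1 D2.
apply: homologous_trans (homologous_trans _ H) _; apply: eq_homologous.
  apply: (@tensor_power_ext _ _ _ _ (bimod_transfer dX (g \o f) (n := n.+1))) => t.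
  rewrite /= bimod_transferE transferE path_trace_block => [|p a b].
    rewrite [X in _ = _ + X](_ : _ = 0) ?addr0.
      by congr path_trace; apply/ffunP => j; rewrite !ffunE; case: ifP.
    rewrite -[RHS](block0 _ (db_rep dY dY idfun) t).
    by congr path_trace; apply/ffunP => j; rewrite !ffunE; case: ifP.
  by rewrite ffunE; case: ifP.
apply: (@tensor_power_ext _ _ _ _ _ (bimod_transfer dY (f \o g) (n := n.+1))) => t.
rewrite /= bimod_transferE transferE path_trace_block => [|p a b].
  rewrite [X in X + _](_ : _ = 0) ?add0r.
    by congr path_trace; apply/ffunP => j; rewrite !ffunE; case: ifP.
  rewrite -[RHS](block0 _ (db_rep dX dX idfun) t).
  by congr path_trace; apply/ffunP => j; rewrite !ffunE; case: ifP.
by rewrite ffunE; case: ifP.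
Qed.
End Commute.
End RightLinear.

Arguments db_vec {k A B X} d _.
Arguments db_coord {k A B X} d _ _.
Arguments db_mx {k A B X Y} dX dY h _ _.
Arguments db_rep {k A B X Y} dX dY e a _ _.
Arguments db_mx_comp {k A B X Y Z} dX dY dZ g f i j.
Arguments db_rep_comp {k A B X Y Z} dX dY dZ g f a b i j.
Arguments bimod_transfer {k A B X} dX e {n}.

(** * Retracts and extensions *)

Section Retract.
Variables (k : fieldType) (A B : algType k) (X Y : bimodType A B).
Variables (dY : dual_basis Y) (i : X -> Y) (p : Y -> X).
Hypotheses (iL : rlinear i) (pL : rlinear p) (ipK : cancel i p).

Lemma retract_coordD j : {morph (fun x => db_coord dY j (i x)) : x y / x + y}.
Proof. by move=> x y; case: iL => -> _; exact: db_coordD. Qed.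
Lemma retract_coord_ract j x b : db_coord dY j (i (ract x b)) = db_coord dY j (i x) * b.
Proof. by case: iL => _ ->; exact: db_coord_ract. Qed.
Lemma retract_expand x : x = \sum_j ract (p (db_vec dY j)) (db_coord dY j (i x)).
Proof.
rewrite -[LHS]ipK {1}[i x](db_expand dY) rlinear_sum //.
by case: pL => _ pr; apply: eq_bigr => j _; rewrite pr.
Qed.

Definition retract_dual_basis : dual_basis X :=
  DualBasis retract_coordD retract_coord_ract retract_expand.
End Retract.

(** The sequence L -> P -> Y is split by maps r and s that are only right
    linear, which suffices to assemble a dual basis of P. *)
Section Split.
Variables (k : fieldType) (A B : algType k) (L P Y : bimodType A B).
Variables (dL : dual_basis L) (dY : dual_basis Y).
Variables (i : {linear L -> P}) (p : {linear P -> Y}) (s : Y -> P) (r : P -> L).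
Hypotheses (sL : rlinear s) (rL : rlinear r).
Hypotheses (pi0 : forall x, p (i x) = 0) (riK : cancel i r) (spK : cancel s p).
Hypothesis split : forall z, z = i (r z) + s (p z).

Definition split_vec (l : db_index dL + db_index dY) : P :=
  match l with inl l => i (db_vec dL l) | inr l => s (db_vec dY l) end.
Definition split_coord (l : db_index dL + db_index dY) (z : P) : B :=
  match l with inl l => db_coord dL l (r z) | inr l => db_coord dY l (p z) end.

Lemma split_coordD l : {morph split_coord l : x y / x + y}.
Proof.
by case: l => l x y /=; rewrite ?linearD ?db_coordD //; case: rL => -> _; rewrite db_coordD.
Qed.
Lemma split_coord_ract l x b : split_coord l (ract x b) = split_coord l x * b.
Proof.
case: l => l /=; first by case: rL => _ ->; rewrite db_coord_ract.
by case: (bimod_rlinear p) => _ ->; rewrite db_coord_ract.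
Qed.
Lemma split_expand z : z = \sum_l ract (split_vec l) (split_coord l z).
Proof.
rewrite big_sumType /= {1}[z]split {1}[r z](db_expand dL) {1}[p z](db_expand dY).
rewrite (rlinear_sum _ (bimod_rlinear i)) (rlinear_sum _ sL).
case: (bimod_rlinear i) => _ ir; case: sL => _ sr.
by congr (_ + _); apply: eq_bigr => l _; rewrite ?ir ?sr.
Qed.

Definition split_dual_basis : dual_basis P :=
  DualBasis split_coordD split_coord_ract split_expand.

Lemma bimod_transfer_split n :
  bimod_transfer split_dual_basis idfun (n := n) =1
  bimod_transfer dL idfun (n := n) \+ bimod_transfer dY idfun (n := n).
Proof.
apply: (@tensor_power_ext _ _ _ _ (bimod_transfer split_dual_basis idfun (n := n))
   (bimod_transfer dL idfun (n := n) \+ bimod_transfer dY idfun (n := n))) => t.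
rewrite /= !bimod_transferE path_trace_block.
  congr (_ + _); congr path_trace; apply/ffunP => j; rewrite !ffunE.
    by rewrite !if_same; apply/funext => a; apply/funext => b;
       rewrite /db_rep /db_mx /= -bimod_lact riK.
  by rewrite !if_same; apply/funext => a; apply/funext => b;
     rewrite /db_rep /db_mx /= bimod_lact spK.
move=> q a b; rewrite ffunE if_same /db_rep /db_mx /= bimod_lact pi0 /lact scaler0.
by apply: (addrI (db_coord dY b 0)); rewrite -db_coordD !addr0.
Qed.
End Split.

(** * Chains with a tail of units *)

Lemma tensor_power_ind (k : fieldType) (V : lmodType k) m (P : tensor_power V m -> Prop) :
  P 0 -> (forall c x y, P x -> P y -> P (c *: x + y)) -> (forall t, P (mtens t)) -> forall x, P x.
Proof.
move=> P0 PD Pt x; rewrite -[x]lquot_projK.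
elim/freeg_ind: (repr x) => [|c t {}x IH]; first by rewrite linear0.
by rewrite linearP; apply: PD => //; exact: Pt.
Qed.

Section Degenerate.
Variables (k : fieldType) (B : algType k).

(** The chain b (x) 1 (x) ... (x) 1. *)
Definition unit_tail n (b : B) : hoch_chain B n := mtens (ffset [ffun => 1] ord0 b).

Lemma unit_tail_linear n : linear (@unit_tail n).
Proof. exact: mtens_multilinear. Qed.
HB.instance Definition _ n :=
  GRing.isLinear.Build k B (hoch_chain B n) _ (@unit_tail n) (@unit_tail_linear n).

(** Every face of a chain with a tail of units is the shorter such chain, so only
    the parity of the number of faces matters. *)
Lemma hoch_diff_unit_tail n b :
  hoch_diff B n.+1 (unit_tail n.+1 b) = if odd n then unit_tail n b else 0.
Proof.
rewrite /= hoch_diff_succE /hoch_bound.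
rewrite (eq_bigr (fun i : 'I_n.+2 => (-1) ^+ i *: unit_tail n b)) => [|i _].
  rewrite -scaler_suml -[odd n]negbK -[~~ odd n]/(odd n.+1) -[~~ odd _]/(odd n.+2).
  elim: n.+2 => [|m IH]; first by rewrite big_ord0 scale0r.
  rewrite big_ord_recr /= scalerDl IH -signr_odd; case: (odd m) => /=.
    by rewrite expr1 scaleN1r subrr.
  by rewrite expr0 scale1r add0r.
congr (_ *: mtens _); apply/ffunP => j; rewrite !ffunE.
have jE : (j == ord0) = (j == 0%N :> nat) by [].
have iE : (i == ord0) = (i == 0%N :> nat) by [].
have lE : (fintype.lift i j == ord0) = (bump i j == 0%N) by [].
rewrite jE iE lE modnS_wrap; last exact: (ltn_ord i).
have -> : (bump i j == 0%N) = (i != 0%N :> nat) && (j == 0%N :> nat) by rewrite /bump; lia.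
have [i0|i0] := eqVneq (nat_of_ord i) 0%N.
  by rewrite i0 /= mulr1.
rewrite /= mul1r; case: (nat_of_ord j == 0%N);
  by case: (nat_of_ord i == n.+1); rewrite ?if_same.
Qed.

Definition append_unit n (t : {ffun 'I_n.+1 -> B}) : hoch_chain B n.+1 :=
  mtens [ffun j => if unlift ord_max j is Some j' then t j' else 1].

Lemma append_unit_multilinear n : multilinear (@append_unit n).
Proof.
move=> t p c x y; rewrite /append_unit.
have E z : [ffun j => if unlift ord_max j is Some j' then ffset t p z j' else 1] =
    ffset [ffun j => if unlift ord_max j is Some j' then t j' else 1] (fintype.lift ord_max p) z
    :> {ffun 'I_n.+2 -> B}.
  apply/ffunP => j; rewrite !ffunE; case: (unliftP ord_max j) => [j' ->|->].
    by rewrite ffunE (inj_eq lift_inj).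
  by rewrite (negPf (neq_lift _ _)).
by rewrite !E; exact: mtens_multilinear.
Qed.

Lemma unit_tail_append n b :
  tensor_power_lift (@append_unit_multilinear n) (unit_tail n b) = unit_tail n.+1 b.
Proof.
rewrite tensor_power_liftE; congr mtens; apply/ffunP => j; rewrite !ffunE.
case: (unliftP ord_max j) => [j' ->|-> //]; rewrite !ffunE.
by rewrite -!val_eqE /= /bump leqNgt ltn_ord.
Qed.

(** Scalars move freely between the slots, so all of them can be collected in
    slot 0. *)
Lemma mtens_scalar_tail n (u : {ffun 'I_n.+1 -> B}) :
  (forall j, j != ord0 -> exists c, u j = c *: 1) -> exists b, mtens u = unit_tail n b.
Proof.
move=> uc.
(* The scalars of slots 1 to m - 1 have been extracted from w m. *)
pose w m : {ffun 'I_n.+1 -> B} := [ffun j : 'I_n.+1 => if (0 < j < m)%N then 1 else u j].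
have wP m : (m <= n.+1)%N -> exists c, mtens u = c *: mtens (w m).
  elim: m => [|m IH] lemn.
    by exists 1; rewrite scale1r; congr mtens; apply/ffunP => j; rewrite ffunE ltn0 andbF.
  have [c ->] := IH (ltnW lemn).
  have [->|nem] := eqVneq m 0%N.
    by exists c; congr (_ *: mtens _); apply/ffunP => j; rewrite !ffunE; case: ifP; case: ifP => //; lia.
  have nem0 : Ordinal lemn != ord0 by rewrite -val_eqE.
  have [d Dd] := uc _ nem0.
  exists (c * d); rewrite -scalerA; congr (_ *: _).
  rewrite (_ : w m = ffset (w m) (Ordinal lemn) (d *: 1)).
    rewrite (multilinearZ (@mtens_multilinear _ _ _)); congr (_ *: mtens _).
    apply/ffunP => j; rewrite !ffunE; case: eqVneq => [->|]; first by rewrite /= lt0n nem leqnn.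
    by rewrite -val_eqE /= => nej; rewrite (_ : (0 < j < m.+1)%N = (0 < j < m)%N) //; lia.
  by apply/ffunP => j; rewrite !ffunE; case: eqVneq => // ->; rewrite ltnn andbF.
have [c Dc] := wP _ (leqnn n.+1).
exists (c *: u ord0); rewrite linearZ Dc; congr (_ *: mtens _).
apply/ffunP => j; rewrite !ffunE ltn_ord andbT lt0n; case: (eqVneq j ord0) => [->|] //.
by rewrite -val_eqE /= => ->.
Qed.
End Degenerate.

(** * Projective bimodules have null transfers *)

Lemma tensop_tens_vbasis (k : fieldType) (A : falgType k) (B : algType k) (a : A) (b : B) :
  tensop_tens a b = \sum_(s < \dim {:A})
    tensop_tens (vbasis {:A})`_s (coord (vbasis {:A}) s a *: b).
Proof.
rewrite {1}(coord_vbasis (memvf a)).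
rewrite (big_morph (fun x => tensop_tens x b) (id1 := 0) (op1 := +%R)).
- by apply: eq_bigr => s _; rewrite /tensop_tens tensZl tensZr.
- by move=> x y; have := tens_linearl b 1 x y; rewrite !scale1r.
- by rewrite /tensop_tens -(scale0r (0 : A)) tensZl scale0r.
Qed.

Section FreeBimodule.
Variables (k : fieldType) (A : falgType k) (B : algType k) (m : nat).
Notation F := ('rV[tensop A B]_m).
Notation d := (\dim {:A}).
Let e : d.-tuple A := vbasis {:A}.

(** As a right B-module, the free bimodule of rank one is a direct sum of copies
    of B, indexed by a basis of A over the base field. *)
Definition left_coord_fun (s : 'I_d) (a : A) (b : B) : B := coord e s a *: b.

Lemma left_coord_linearl s b : linear ((left_coord_fun s)^~ b).
Proof. by move=> c a a'; rewrite /left_coord_fun linearP scalerDl scalerA. Qed.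
Lemma left_coord_linearr s a : linear (left_coord_fun s a).
Proof. by move=> c b b'; rewrite /left_coord_fun scalerDr !scalerA mulrC. Qed.

Definition left_coord s : tensop A B -> B :=
  tensor_lift (left_coord_linearl s) (left_coord_linearr s).
HB.instance Definition _ s := GRing.Linear.on (left_coord s).

Lemma left_coordE s a b : left_coord s (tensop_tens a b) = coord e s a *: b.
Proof. exact: tensor_liftE. Qed.

Lemma left_coord_expand t : t = \sum_(s < d) tensop_tens e`_s (left_coord s t).
Proof.
elim/tensor_ind: t => [|x y IHx IHy|a b].
- rewrite big1 // => s _; rewrite linear0 /tensop_tens.
  by rewrite -(scale0r (0 : B)) tensZr scale0r.
- rewrite [in LHS]IHx [in LHS]IHy -big_split; apply: eq_bigr => s _.
  rewrite linearD /=; have := tens_linearr (e`_s : A) 1 (left_coord s x) (left_coord s y).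
  by rewrite !scale1r.
rewrite [LHS](tensop_tens_vbasis a b); apply: eq_bigr => s _.
by rewrite [left_coord _ _](left_coordE s a b).
Qed.

Lemma left_coord_ract s t b : left_coord s (tensop_tens 1 b * t) = left_coord s t * b.
Proof.
elim/tensor_ind: t => [|x y IHx IHy|a' b'].
- by rewrite mulr0 linear0 mul0r.
- by rewrite mulrDr !linearD /= IHx IHy mulrDl.
rewrite -[tens a' b']/(tensop_tens a' b') tensop_mul_tens !left_coordE mul1r.
by rewrite scalerAl.
Qed.

Definition free_vec (q : 'I_m * 'I_d) : F := tensop_tens e`_q.2 1 *: delta_mx 0 q.1.
Definition free_coord (q : 'I_m * 'I_d) (x : F) : B := left_coord q.2 (x 0 q.1).

Lemma free_coordD q : {morph free_coord q : x y / x + y}.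
Proof. by move=> x y; rewrite /free_coord mxE linearD. Qed.
Lemma free_coord_ract q x b : free_coord q (ract x b) = free_coord q x * b.
Proof. by rewrite /free_coord mxE left_coord_ract. Qed.
Lemma free_expand x : x = \sum_q ract (free_vec q) (free_coord q x).
Proof.
rewrite {1}[x]row_sum_delta -(pair_bigA _ (fun r s => ract (free_vec (r, s)) (free_coord (r, s) x))) /=.
apply: eq_bigr => r _; rewrite {1}[x 0 r]left_coord_expand scaler_suml; apply: eq_bigr => s _.
by rewrite /ract /free_vec /free_coord scalerA tensop_mul_tens ?mul1r ?mulr1.
Qed.

Definition free_dual_basis : dual_basis F :=
  DualBasis free_coordD free_coord_ract free_expand.

(** The left action of A on a free bimodule only involves the structure constants
    of A. *)
Lemma free_rep_scalar a i j : exists c, db_rep free_dual_basis free_dual_basis idfun a i j = c *: 1.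
Proof.
exists (coord e i.2 (a * e`_j.2) *+ (i.1 == j.1)).
rewrite /db_rep /db_mx /= /free_coord /lact /free_vec scalerA tensop_mul_tens !mxE eqxx /=.
case: eqP => _ /=; first by rewrite !mulr1 left_coordE mulr1n.
by rewrite mulr0 linear0 mulr0n scale0r.
Qed.

Lemma free_transfer_unit_tail (w : {linear F -> F}) n (z : hoch_chain A n) :
  exists b, bimod_transfer free_dual_basis w z = unit_tail n b.
Proof.
elim/tensor_power_ind: z => [|c x y [b Db] [b' Db']|t].
- by exists 0; rewrite !linear0.
- by exists (c *: b + b'); rewrite !linearP /= Db Db'.
rewrite bimod_transferE /path_trace.
elim/big_rec: _ => [|g x _ [b ->]]; first by exists 0; rewrite linear0.
set u := path_entries _ g.
have /mtens_scalar_tail[b' ->] j : j != ord0 -> exists c, u j = c *: 1.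
  by move=> nej; rewrite /u path_entriesE ffunE (negPf nej); exact: free_rep_scalar.
by exists (b' + b); rewrite linearD.
Qed.

(** A value of the transfer is a chain with a tail of units.  In odd degree (n
    even) every such chain is the boundary of the next one.  In even degree its
    differential is the previous such chain, which therefore vanishes on cycles,
    and appending a unit shows that the chain itself vanishes. *)
Lemma free_transfer_null (w : {linear F -> F}) n :
  homologous (bimod_transfer free_dual_basis w (n := n.+1)) \0.
Proof.
move=> z dz; have [b Db] := free_transfer_unit_tail w z.
rewrite /= subr0 Db; have [oddn|evn] := boolP (odd n); last first.
  by exists (unit_tail n.+2 b); rewrite [RHS]hoch_diff_unit_tail /= evn.
exists 0; rewrite linear0 -unit_tail_append.
have := hoch_diff_unit_tail n b; rewrite oddn => <-.
by rewrite -Db bimod_transfer_diff dz !linear0.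
Qed.
End FreeBimodule.

Section Projective.
Variables (k : fieldType) (A : falgType k) (B : algType k) (P : bimodType A B).
Hypotheses (fpP : finitely_presented P) (projP : projective P).

Lemma projective_retract : exists m (p : {linear 'rV[tensop A B]_m -> P})
  (i : {linear P -> 'rV[tensop A B]_m}), cancel i p.
Proof.
have [l [m [f [g [_ gs]]]]] := fpP; exists m, g.
by have [i Di] := projP idfun gs; exists i.
Qed.

Lemma projective_dual_basis : inhabited (dual_basis P).
Proof.
have [m [p [i ipK]]] := projective_retract.
constructor.
exact: (retract_dual_basis (free_dual_basis A B m) (bimod_rlinear i) (bimod_rlinear p) ipK).
Qed.

(** Through a free bimodule F that retracts onto P, the trace property moves the
    endomorphism vu of X to an endomorphism of F. *)
Lemma transfer_through_projective (X : bimodType A B) (dX : dual_basis X)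
    (u : {linear X -> P}) (v : {linear P -> X}) n :
  homologous (bimod_transfer dX (v \o u) (n := n.+1)) \0.
Proof.
have [m [p [i ipK]]] := projective_retract.
apply: (homologous_trans _ (free_transfer_null ((i \o u) \o (v \o p)) (n := n))).
apply: (homologous_trans _ (bimod_transfer_commute dX (free_dual_basis A B m) (i \o u) (v \o p) (n := n))).
by apply/eq_homologous/eq_bimod_transfer => x /=; rewrite ipK.
Qed.
End Projective.

(** * Tensor products and the regular bimodule *)

Section TensorOverTransfer.
Variables (k : fieldType) (A B C : algType k).
Variables (M : bimodType A B) (N : bimodType B C).
Variables (dM : dual_basis M) (dN : dual_basis N).
Notation I := (db_index dM * db_index dN)%type.

Definition tensor_coord_fun (q : I) (x : M) (y : N) : C :=
  db_coord dN q.2 (lact (db_coord dM q.1 x) y).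

Lemma tensor_coord_linearl q y :
  linear ((tensor_coord_fun q)^~ y : vspace_module M -> C).
Proof.
move=> c x x'; rewrite /tensor_coord_fun db_coordD db_coordZ lact_linearl.
by rewrite db_coordD db_coordZ.
Qed.
Lemma tensor_coord_linearr q x : linear (tensor_coord_fun q x : vspace_module N -> C).
Proof. by move=> c y y'; rewrite /tensor_coord_fun lact_linear db_coordD db_coordZ. Qed.
Lemma tensor_coord_balanced q x b y :
  tensor_coord_fun q (ract x b) y = tensor_coord_fun q x (lact b y).
Proof. by rewrite /tensor_coord_fun db_coord_ract lactM. Qed.

Definition tensor_coord q : tensor_over M N -> C :=
  tensor_over_lift (tensor_coord_linearl q) (tensor_coord_linearr q) (tensor_coord_balanced q).

Lemma tensor_coordE q x y : tensor_coord q (tens_over x y) = tensor_coord_fun q x y.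
Proof. exact: tensor_over_liftE. Qed.

Lemma tensor_over_lactM a (x : M) (y : N) :
  lact a (tens_over x y : tensor_over M N) = tens_over (lact a x) y.
Proof. by rewrite /lact [LHS]bimodule_scaleE tensor_over_ractE tensor_over_lactE ract1. Qed.

Lemma tensor_over_ractM c (x : M) (y : N) :
  ract (tens_over x y : tensor_over M N) c = tens_over x (ract y c).
Proof. by rewrite /ract [LHS]bimodule_scaleE tensor_over_ractE tensor_over_lactE lact1. Qed.

Lemma tensor_coordD q : {morph tensor_coord q : x y / x + y}.
Proof. by move=> x y; rewrite /tensor_coord linearD. Qed.

Lemma tensor_coord_ract q t c : tensor_coord q (ract t c) = tensor_coord q t * c.
Proof.
elim/tensor_over_ind: t => [|s t IHs IHt|x y].
- by rewrite /ract scaler0 /tensor_coord linear0 mul0r.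
- by rewrite /ract scalerDr !tensor_coordD IHs IHt mulrDl.
by rewrite tensor_over_ractM !tensor_coordE /tensor_coord_fun lact_ract db_coord_ract.
Qed.

Definition tensor_vec (q : I) : tensor_over M N := tens_over (db_vec dM q.1) (db_vec dN q.2).

Lemma tens_over_suml (J : finType) (F : J -> M) (y : N) :
  tens_over (\sum_j F j) y = \sum_j tens_over (F j) y.
Proof.
have D (x x' : M) : tens_over (x + x') y = tens_over x y + tens_over x' y.
  by have := tens_over_linearl y 1 (x : vspace_module M) x'; rewrite !scale1r.
by apply: (big_morph (fun x : M => tens_over x y) D); apply: (addrI (tens_over 0 y)); rewrite -D !addr0.
Qed.

Lemma tens_over_sumr (J : finType) (x : M) (F : J -> N) :
  tens_over x (\sum_j F j) = \sum_j tens_over x (F j).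
Proof.
have D (y y' : N) : tens_over x (y + y') = tens_over x y + tens_over x y'.
  by have := tens_over_linearr x 1 (y : vspace_module N) y'; rewrite !scale1r.
by apply: (big_morph (fun y : N => tens_over x y) D); apply: (addrI (tens_over x 0)); rewrite -D !addr0.
Qed.

Lemma tensor_expand t : t = \sum_q ract (tensor_vec q) (tensor_coord q t).
Proof.
elim/tensor_over_ind: t => [|s t IHs IHt|x y].
- rewrite big1 // => q _; rewrite /ract /tensor_coord linear0.
  by rewrite /tensop_tens -(scale0r (0 : C)) tensZr scale0r scale0r.
- rewrite [in LHS]IHs [in LHS]IHt -big_split; apply: eq_bigr => q _.
  by rewrite tensor_coordD; have := ract_linearr (tensor_vec q) 1 (tensor_coord q s) (tensor_coord q t);
     rewrite !scale1r.
rewrite -(pair_bigA _ (fun i j => ract (tensor_vec (i, j)) (tensor_coord (i, j) (tens_over x y)))) /=.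
rewrite {1}[x](db_expand dM) tens_over_suml; apply: eq_bigr => i _.
rewrite tens_over_balanced {1}[lact _ y](db_expand dN) tens_over_sumr.
by apply: eq_bigr => j _; rewrite tensor_over_ractM tensor_coordE.
Qed.

Definition tensor_dual_basis : dual_basis (tensor_over M N) :=
  DualBasis tensor_coordD tensor_coord_ract tensor_expand.

(** The matrix representation of the tensor product is the composite of the two
    representations, and a closed path of pairs of indices is a pair of
    closed paths. *)
Lemma bimod_transfer_tensor n (z : hoch_chain A n) :
  bimod_transfer tensor_dual_basis idfun z = bimod_transfer dN idfun (bimod_transfer dM idfun z).
Proof.
apply: (@tensor_power_ext _ _ _ _ (bimod_transfer tensor_dual_basis idfun (n := n))
   (bimod_transfer dN idfun (n := n) \o bimod_transfer dM idfun (n := n))) => t.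
rewrite /= !bimod_transferE {2}/path_trace linear_sum /=.
under [RHS]eq_bigr => g _ do rewrite bimod_transferE.
rewrite /path_trace pair_bigA /=.
pose pairf (p : {ffun 'I_n.+1 -> db_index dM} * {ffun 'I_n.+1 -> db_index dN}) :
  {ffun 'I_n.+1 -> I} := [ffun j => (p.1 j, p.2 j)].
rewrite (reindex pairf) /=; last first.
  exists (fun g : {ffun 'I_n.+1 -> I} => ([ffun j => (g j).1], [ffun j => (g j).2])) => [[g h] _|g _].
    by congr (_, _); apply/ffunP => j; rewrite !ffunE.
  by apply/ffunP => j; rewrite !ffunE; case: (g j).
apply: eq_bigr => -[g h] _; congr mtens; apply/ffunP => j.
rewrite !path_entriesE !ffunE !if_same /=.
by rewrite /db_rep /db_mx /= tensor_over_lactM tensor_coordE.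
Qed.
End TensorOverTransfer.

Section RegularTransfer.
Variables (k : fieldType) (A : algType k).
Notation R := (regular_bimodule A).

Lemma regular_lact a (x : R) : lact a x = a * (x : A).
Proof. by rewrite /lact [LHS]bimodule_scaleE mulr1. Qed.
Lemma regular_ract a (x : R) : ract x a = (x : A) * a.
Proof. by rewrite /ract [LHS]bimodule_scaleE mul1r. Qed.

Definition regular_coord (i : unit) (x : R) : A := x.
Definition regular_vec (i : unit) : R := (1 : A).

Lemma regular_coordD i : {morph regular_coord i : x y / x + y}. Proof. by []. Qed.
Lemma regular_coord_ract i x b : regular_coord i (ract x b) = regular_coord i x * b.
Proof. exact: regular_ract. Qed.
Lemma regular_expand x : x = \sum_i ract (regular_vec i) (regular_coord i x).
Proof. by rewrite (big_pred1 tt) => [|[]] //; rewrite regular_ract mul1r. Qed.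

Definition regular_dual_basis : dual_basis R :=
  DualBasis regular_coordD regular_coord_ract regular_expand.

Lemma bimod_transfer_regular n (z : hoch_chain A n) :
  bimod_transfer regular_dual_basis idfun z = z.
Proof.
apply: (@tensor_power_ext _ _ _ _ (bimod_transfer regular_dual_basis idfun (n := n)) idfun) => t.
rewrite /= bimod_transferE /path_trace (bigD1 [ffun=> tt]) //= big1 ?addr0; last first.
  by move=> g /eqP[]; apply/ffunP => j; rewrite ffunE; case: (g j).
congr mtens; apply/ffunP => j; rewrite path_entriesE ffunE if_same.
by rewrite /db_rep /db_mx /= /regular_coord regular_lact mulr1.
Qed.
End RegularTransfer.

Section RightProjective.
Variables (k : fieldType) (A : falgType k) (B : algType k) (M : bimodType A B).
Hypotheses (fgM : finitely_generated M) (projM : projective (right_module M)).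

(** Multiplying bimodule generators by a basis of A gives generators on the
    right; a section of the resulting map from a free right module provides the
    coordinates. *)
Lemma right_projective_dual_basis : inhabited (dual_basis M).
Proof.
have [m [g Dg]] := fgM.
pose d := \dim {:A}; pose e : d.-tuple A := vbasis {:A}.
pose I := ('I_m * 'I_d)%type.
pose x (q : I) : M := lact e`_q.2 (g q.1).
pose F := {ffun I -> (B^c)^o}.
pose f (u : F) : right_module M := \sum_q (u q : B^c) *: (x q : right_module M).
have fL : linear f.
  move=> c u v; rewrite /f scaler_sumr -big_split; apply: eq_bigr => q _ /=.
  by rewrite !ffunE scalerDl scalerA.
pose f' : {linear F -> right_module M} := HB.pack f (GRing.isLinear.Build _ _ _ _ f fL).
have fs : lin_surjective f'.
  have imD y z : (exists u, f' u = y) -> (exists u, f' u = z) -> exists u, f' u = y + z :> right_module M.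
    by case=> u <- [v <-]; exists (u + v); rewrite linearD.
  have im0 : exists u, f' u = 0 by exists 0; rewrite linear0.
  move=> y; have [c ->] := Dg y.
  apply: (big_ind (fun z : M => exists u, f' u = z)) => // i _.
  elim/tensor_ind: (c i) => [|s t IHs IHt|a b]; first by rewrite scale0r.
    by rewrite scalerDl; exact: imD.
  (* Every element a (x) b acting on a generator is reached by expanding a. *)
  pose u : F := [ffun q => if q.1 == i then coord e q.2 a *: b else 0].
  exists u; rewrite -[LHS]/(f u) /f.
  rewrite (eq_bigr (fun q => if q.1 == i then tensop_tens 1 (coord e q.2 a *: b) *: (x (q.1, q.2) : M) else 0)); last first.
    by move=> [r s] _; rewrite ffunE; case: ifP => // _; exact: (@scale0r B^c (right_module M) (x (r, s))).
  rewrite -(pair_bigA _ (fun r s => if r == i then tensop_tens 1 (coord e s a *: b) *: (x (r, s) : M) else 0)) /=.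
  rewrite (bigD1 i) //= eqxx [X in _ + X]big1 ?addr0 => [|r /negPf->]; last by rewrite big1.
  rewrite [tens a b](tensop_tens_vbasis a b).
  rewrite scaler_suml; apply: eq_bigr => s _.
  by rewrite /x /lact scalerA tensop_mul_tens ?mul1r ?mulr1.
have [h Dh] := projM idfun fs.
have hD q : {morph (fun y : M => h y q : B) : y z / y + z}.
  by move=> y z; rewrite -[h (y + z)]/(h ((y : right_module M) + z)) linearD ffunE.
have hr q y b : (h (ract y b) q : B) = (h y q : B) * b.
  by rewrite -[ract y b]/((b : B^c) *: (y : right_module M)) linearZ ffunE.
have hx z : z = \sum_q ract (x q) (h z q : B).
  by rewrite -[LHS]Dh.
by constructor; exact: (DualBasis hD hr hx).
Qed.
End RightProjective.

(** * Syzygies and stable isomorphisms *)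

Section Invariance.
Variables (k : fieldType) (A B : algType k).

Lemma bimod_transfer_iso (X Y : bimodType A B) (dX : dual_basis X) (dY : dual_basis Y)
    (f : {linear X -> Y}) (g : {linear Y -> X}) n : cancel f g -> cancel g f ->
  homologous (bimod_transfer dX idfun (n := n.+1)) (bimod_transfer dY idfun (n := n.+1)).
Proof.
move=> fK gK; have H := bimod_transfer_commute dX dY f g (n := n).
apply: homologous_trans (homologous_trans _ H) _;
  by apply/eq_homologous/eq_bimod_transfer => x /=; rewrite ?fK ?gK.
Qed.

Lemma lin_isomorphic_dual_basis (X Y : bimodType A B) (dX : dual_basis X) n :
    lin_isomorphic X Y ->
  exists dY : dual_basis Y,
    homologous (bimod_transfer dY idfun (n := n.+1)) (bimod_transfer dX idfun (n := n.+1)).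
Proof.
case=> f [g fK gK].
have gL : linear g by move=> c x y; rewrite -[c *: x + y]gK -{1}[x]gK -{1}[y]gK -linearP !fK.
pose gT := GRing.isLinear.Build _ _ _ _ g gL.
pose g' : {linear Y -> X} := HB.pack g gT.
exists (retract_dual_basis dX (bimod_rlinear g') (bimod_rlinear f) gK).
exact: (bimod_transfer_iso _ _ (f := g') (g := f) gK fK).
Qed.
End Invariance.

Section Syzygy.
Variables (k : fieldType) (A : falgType k) (B : algType k).

(** Additivity for an extension by a projective middle term.  L inherits a dual
    basis from P as a right-linear retract, and P gets a second one
    adapted to the extension; the transfer vanishes for the latter as for
    any other. *)
Lemma short_exact_transfer (L P Y : bimodType A B) (i : {linear L -> P})
    (p : {linear P -> Y}) (dY : dual_basis Y) n :
    finitely_presented P -> projective P -> short_exact i p ->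
  exists dL : dual_basis L,
    homologous (bimod_transfer dL idfun (n := n.+1)) (\- bimod_transfer dY idfun (n := n.+1)).
Proof.
move=> fpP projP [iI ip ps].
have [dP] := projective_dual_basis fpP projP.
have [pre Dpre] : {pre : db_index dY -> P & forall j, p (pre j) = db_vec dY j}.
  by apply: (@choice _ _ (fun j x => p x = db_vec dY j)) => j; exact: ps.
pose s y := \sum_j ract (pre j) (db_coord dY j y).
have sL : rlinear s.
  split=> [x y|x b].
    rewrite /s -big_split; apply: eq_bigr => j _.
    by rewrite db_coordD; have := ract_linearr (pre j) 1 (db_coord dY j x) (db_coord dY j y);
       rewrite !scale1r.
  rewrite /s [RHS]/ract scaler_sumr; by apply: eq_bigr => j _; rewrite db_coord_ract ractM.
have pr : forall x b, p (ract x b) = ract (p x) b by case: (bimod_rlinear p).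
have spK : cancel s p.
  move=> y; rewrite /s linear_sum [RHS](db_expand dY).
  by apply: eq_bigr => j _; rewrite /= pr Dpre.
have [r Dr] : {r : P -> L & forall z, i (r z) = z - s (p z)}.
  apply: (@choice _ _ (fun z x => i x = z - s (p z))) => z.
  by apply/ip; rewrite linearB spK subrr.
have split z : z = i (r z) + s (p z) by rewrite Dr subrK.
have [sD sr] := sL.
have rL : rlinear r.
  split=> [x y|x b]; apply: iI.
    by rewrite linearD !Dr linearD sD opprD addrACA.
  case: (bimod_rlinear i) => _ ->; rewrite !Dr pr sr.
  by rewrite /ract scalerBr.
have pi0 x : p (i x) = 0 by apply/ip; exists x.
have s0 : s 0 = 0 by apply: (addrI (s 0)); rewrite -sD !addr0.
have riK : cancel i r by move=> x; apply: iI; rewrite Dr pi0 s0 subr0.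
pose dL := retract_dual_basis dP (bimod_rlinear i) rL riK.
exists dL; pose dP' := split_dual_basis dL dY sL rL split.
have T0 : homologous (bimod_transfer dP' idfun (n := n.+1)) \0.
  apply: homologous_trans (transfer_through_projective fpP projP dP' idfun idfun (n := n)).
  exact/eq_homologous/eq_bimod_transfer.
move=> z dz; have [w Dw] := T0 z dz; exists w; rewrite -Dw.
by rewrite [in RHS]bimod_transfer_split //= opprK subr0.
Qed.

Lemma syzygy_transfer n m (Y K : bimodType A B) (dY : dual_basis Y) : is_syzygy n Y K ->
  exists dK : dual_basis K,
    homologous (bimod_transfer dK idfun (n := m.+1))
               (fun z => (-1) ^+ n *: bimod_transfer dY idfun (n := m.+1) z).
Proof.
elim: n Y dY => [|n IH] Y dY /=.
  move=> /(lin_isomorphic_dual_basis dY m)[dK H]; exists dK.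
  by apply: homologous_trans H _; apply: eq_homologous => z; rewrite scale1r.
case=> P [L [i [p [fpP projP ip]]]].
have [dL HL] := short_exact_transfer dY m fpP projP ip.
move=> /(IH _ dL)[dK HK]; exists dK.
move=> z dz; have [w Dw] := HK z dz; have [w' Dw'] := HL z dz.
exists (w + (-1) ^+ n *: w').
rewrite [RHS]linearD [X in _ = _ + X]linearZ -Dw -Dw' /= exprS mulN1r scaleNr opprK scalerDr scalerN.
by rewrite scalerN opprK addrA subrK.
Qed.

Lemma stably_eq_transfer (X : bimodType A B) (dX : dual_basis X) (e : {linear X -> X}) n :
  stably_eq e idfun ->
  homologous (bimod_transfer dX e (n := n.+1)) (bimod_transfer dX idfun (n := n.+1)).
Proof.
case=> P [u [v [fpP projP De]]].
have De' x : e x = (idfun : {linear X -> X}) x + (v \o u) x by rewrite /= -De addrC subrK.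
move=> z dz; have [w Dw] := transfer_through_projective fpP projP dX u v dz.
by exists w; rewrite (bimod_transferD _ De') -Dw /= subr0 addrAC subrr add0r.
Qed.

(** The trace property compares T_X(gf) with T_Y(fg), and each of gf and fg
    differs from the identity by a map that factors through a projective. *)
Lemma stably_isomorphic_transfer (X Y : bimodType A B) (dX : dual_basis X)
    (dY : dual_basis Y) n : stably_isomorphic X Y ->
  homologous (bimod_transfer dX idfun (n := n.+1)) (bimod_transfer dY idfun (n := n.+1)).
Proof.
case=> _ _ [f [g [gf fg]]].
apply: homologous_trans (homologous_sym (stably_eq_transfer dX gf (n := n))) _.
apply: homologous_trans (bimod_transfer_commute dX dY f g (n := n)) _.
exact: stably_eq_transfer.
Qed.
End Syzygy.

(** * From chain maps to homology *)

Section HomologyMap.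
Variables (k : fieldType) (U V W U' V' W' : lmodType k).
Variables (f : {linear U -> V}) (g : {linear V -> W}).
Variables (f' : {linear U' -> V'}) (g' : {linear V' -> W'}).
Variables (phi : {linear V -> V'}).
Hypothesis phi_cycle : forall z, g z = 0 -> g' (phi z) = 0.
Hypothesis phi_boundary : forall u, exists u', phi (f u) = f' u'.

Lemma cycle_map_subproof (z : cycles g) : phi (val z) \in cycle_pred g'.
Proof. by rewrite unfold_in; apply/eqP/phi_cycle/eqP; have := valP z; rewrite unfold_in. Qed.

Definition cycle_map (z : cycles g) : cycles g' := exist _ (phi (val z)) (cycle_map_subproof z).

Lemma cycle_map_linear : linear cycle_map.
Proof. by move=> c x y; apply: val_inj; rewrite /= !linearP. Qed.
HB.instance Definition _ :=
  GRing.isLinear.Build k (cycles g) (cycles g') _ cycle_map cycle_map_linear.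

Lemma cycle_map_boundary z : boundary_rel f z ->
  (lquot_proj (boundary_rel f' (g := g')) \o cycle_map) z = 0.
Proof.
case=> {}z u Dz; have [u' Du'] := phi_boundary u.
by apply/lquot_proj0/(BoundaryRel (u := u')); rewrite /= Dz.
Qed.

Definition homology_map : homology f g -> homology f' g' := lquot_lift cycle_map_boundary.
HB.instance Definition _ := GRing.Linear.on homology_map.

Lemma homology_mapE z : homology_map (lquot_proj _ z) = lquot_proj _ (cycle_map z).
Proof. exact: (lquot_liftE cycle_map_boundary). Qed.
End HomologyMap.

Section HomologyIso.
Variables (k : fieldType) (U V W U' V' W' : lmodType k).
Variables (f : {linear U -> V}) (g : {linear V -> W}).
Variables (f' : {linear U' -> V'}) (g' : {linear V' -> W'}).
Variables (phi : {linear V -> V'}) (psi : {linear V' -> V}) (c : k).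
Hypothesis phi_cycle : forall z, g z = 0 -> g' (phi z) = 0.
Hypothesis phi_boundary : forall u, exists u', phi (f u) = f' u'.
Hypothesis psi_cycle : forall z, g' z = 0 -> g (psi z) = 0.
Hypothesis psi_boundary : forall u, exists u', psi (f' u) = f u'.
Hypothesis psi_phi : forall z, g z = 0 -> exists u, psi (phi z) - c *: z = f u.

Lemma homology_map_scale x :
  homology_map psi_cycle psi_boundary (homology_map phi_cycle phi_boundary x) = c *: x.
Proof.
rewrite -[x]lquot_projK !homology_mapE -linearZ; apply/lquot_proj_eqP/lspan_gen.
have gx : g (val (repr x)) = 0 by apply/eqP; have := valP (repr x); rewrite unfold_in.
have [u Du] := psi_phi gx.
by apply: (BoundaryRel (u := u)); rewrite -Du.
Qed.
End HomologyIso.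

Section HochschildHomology.
Variables (k : fieldType) (A B : algType k) (c : k) (n : nat).
Variables (phi : forall m, {linear hoch_chain A m -> hoch_chain B m}).
Variables (psi : forall m, {linear hoch_chain B m -> hoch_chain A m}).
Hypothesis phi_diff : forall m z, hoch_diff B m.+1 (phi m.+1 z) = phi m (hoch_diff A m.+1 z).
Hypothesis psi_diff : forall m z, hoch_diff A m.+1 (psi m.+1 z) = psi m (hoch_diff B m.+1 z).
Hypothesis c0 : c != 0.
Hypothesis psi_phi : homologous (fun z => psi n.+1 (phi n.+1 z)) (fun z => c *: z).
Hypothesis phi_psi : homologous (fun z => phi n.+1 (psi n.+1 z)) (fun z => c *: z).

(** Chain maps in both directions whose composites are the same nonzero scalar in
    one degree of homology; the inverse of phi is psi divided by that
    scalar. *)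
Lemma HH_isomorphic : lin_isomorphic (HH A n.+1) (HH B n.+1).
Proof.
have phi_cycle z : hoch_diff A n.+1 z = 0 -> hoch_diff B n.+1 (phi n.+1 z) = 0.
  by move=> dz; rewrite phi_diff dz linear0.
have psi_cycle z : hoch_diff B n.+1 z = 0 -> hoch_diff A n.+1 (psi n.+1 z) = 0.
  by move=> dz; rewrite psi_diff dz linear0.
have phi_boundary u : exists u', phi n.+1 (hoch_diff A n.+2 u) = hoch_diff B n.+2 u'.
  by exists (phi n.+2 u); rewrite phi_diff.
have psi_boundary u : exists u', psi n.+1 (hoch_diff B n.+2 u) = hoch_diff A n.+2 u'.
  by exists (psi n.+2 u); rewrite psi_diff.
pose F : {linear HH A n.+1 -> HH B n.+1} := homology_map phi_cycle phi_boundary.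
pose G : {linear HH B n.+1 -> HH A n.+1} := homology_map psi_cycle psi_boundary.
have GF x : G (F x) = c *: x by apply: homology_map_scale.
have FG x : F (G x) = c *: x by apply: homology_map_scale.
exists F; exists (fun y => c^-1 *: G y) => x; first by rewrite GF scalerA mulVf // scale1r.
by rewrite linearZ /= FG scalerA mulVf // scale1r.
Qed.
End HochschildHomology.

(** The composite of the transfers of M and N is the transfer of a bimodule that
    is stably isomorphic to an n-th syzygy of A. *)
Lemma sing_equiv_transfer (k : fieldType) (A B : falgType k) (n m : nat)
    (M : bimodType A B) (N : bimodType B A) (dM : dual_basis M) (dN : dual_basis N) :
    (exists2 K : bimodType A A, is_syzygy n (regular_bimodule A) K &
       stably_isomorphic (tensor_over M N) K) ->
  homologous (fun z => bimod_transfer dN idfun (n := m.+1) (bimod_transfer dM idfun z))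
             (fun z => (-1) ^+ n *: z).
Proof.
case=> K sK MNK.
have [dK HK] := syzygy_transfer m (regular_dual_basis A) sK.
have H := homologous_trans
  (stably_isomorphic_transfer (tensor_dual_basis dM dN) dK MNK (n := m)) HK.
apply: homologous_trans (homologous_trans _ H) _.
  by apply: eq_homologous => z; rewrite bimod_transfer_tensor.
by apply: eq_homologous => z; rewrite bimod_transfer_regular.
Qed.

Theorem proposition3p7 (k : fieldType) (A B : falgType k)
  (hA : infinite_global_dimension A) (hB : infinite_global_dimension B)
  (hAB : exists (n : nat) (M : bimodType A B) (N : bimodType B A),
     sing_equiv_level n M N)
  (i : nat) (hi : (0 < i)%N) :
  lin_isomorphic (HH A i) (HH B i).
Proof.
case: i hi => // i _; have [n [M [N [fgM fgN _ pM _ pN hMN hNM]]]] := hAB.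
have [dM] := right_projective_dual_basis fgM pM.
have [dN] := right_projective_dual_basis fgN pN.
apply: (@HH_isomorphic k A B ((-1) ^+ n) i (fun m => bimod_transfer dM idfun (n := m))
   (fun m => bimod_transfer dN idfun (n := m))).
- by move=> m z; exact: bimod_transfer_diff.
- by move=> m z; exact: bimod_transfer_diff.
- by rewrite signr_eq0.
- exact: sing_equiv_transfer hMN.
- exact: sing_equiv_transfer hNM.
Qed.
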